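(* Let $X$ be a real Banach space, $F:X\to X^*$ and $\Phi:X\rightrightarrows X$. Assume that (i) $F$ is bounded and pseudomonotone, (ii) $\Phi$ is weakly Mosco-continuous, and (iii) there is a nonempty, convex, weakly compact set $A\subseteq X$ such that, for all $x\in A$, $\Phi(x)$ is nonempty, closed, convex, and contained in $A$. Then the QVI $$x\in\Phi(x),\qquad \langle F(x),d\rangle\ge0\quad\forall d\in\mathcal{T}_{\Phi(x)}(x)$$ admits a solution $\bar{x}\in A$.
   Context: $X^*$ is the continuous dual of $X$. Bounded operator: maps bounded sets to bounded sets. Pseudomonotone (in the sense of Brezis): $T:X\to X^*$ is pseudomonotone if, for every sequence $\{x^k\}\subseteq X$ with $x^k\rightharpoonup x\in X$ and $\limsup_{k\to\infty}\langle T(x^k),x^k-x\rangle\le0$, one has $\langle T(x),x-y\rangle\le\liminf_{k\to\infty}\langle T(x^k),x^k-y\rangle$ for all $y\in X$. Mosco convergence: subsets $S_k\subseteq X$ Mosco converge to $S\subseteq X$ if (i) for every $y\in S$ there is a sequence $y^k\in S_k$ with $y^k\to y$, and (ii) whenever $y^k\in S_k$ for all $k$ and $y$ is a weak limit point (weak limit of a subsequence) of $\{y^k\}$, then $y\in S$. Weak Mosco-continuity: $\Phi$ is weakly Mosco-continuous if, for every $x\in X$, $x^k\rightharpoonup x$ implies that $\Phi(x^k)$ Mosco converges to $\Phi(x)$. Tangent cone: for $z\in S$, $\mathcal{T}_S(z)=\{d:\exists\,z^k\to z,\ t_k\downarrow0\text{ with }z^k\in S,\ (z^k-z)/t_k\to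 d\}$. For convex $\Phi(x)$, the QVI is equivalent to $x\in\Phi(x)$, $\langle F(x),y-x\rangle\ge0$ for all $y\in\Phi(x)$. *)

(* Defs.v *)
From HB Require Import structures.
From mathcomp Require Import all_boot all_order all_algebra.
From mathcomp Require Import all_classical all_reals all_analysis.

Set Implicit Arguments.
Unset Strict Implicit.
Unset Printing Implicit Defensive.

Import Order.TTheory GRing.Theory Num.Theory.
Import numFieldNormedType.Exports.

Local Open Scope classical_set_scope.
Local Open Scope ring_scope.

Record dual (R : realType) (X : normedModType R) := Dual {
  dual_fun :> {linear X -> R^o};
  dual_continuous : continuous dual_fun }.

Definition dual_pairing (R : realType) (X : normedModType R)
  (f : dual X) (x : X) : R := f x.

Definition dual_norm (R : realType) (X : normedModType R) (f : dual X) : R :=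
  sup [set `|dual_pairing f x| | x in [set x : X | `|x| <= 1]].

(* `dual X` is not given a normedModType structure, hence the library's
   `bounded_set` is not available on it. *)
Definition dual_bounded_set (R : realType) (X : normedModType R)
    (B : set (dual X)) : Prop :=
  exists M : R, forall f, B f -> dual_norm f <= M.

Definition bounded_operator (R : realType) (X : normedModType R)
    (T : X -> dual X) : Prop :=
  forall B : set X, bounded_set B -> dual_bounded_set (T @` B).

(* X with its weak topology: the coarsest one making all f in `dual X`
   continuous. *)
Definition weak_space (R : realType) (X : normedModType R) : topologicalType :=
  sup_topology (fun f : dual X => Topological.on (initial_topology (dual_pairing f))).

Definition weak_cvg (R : realType) (X : normedModType R)
    (u : nat -> X) (x : X) : Prop :=
  (u : nat -> weak_space X) @ \oo --> (x : weak_space X).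

Definition weakly_compact (R : realType) (X : normedModType R)
    (A : set X) : Prop :=
  compact (A : set (weak_space X)).

Lemma weak_cvgP (R : realType) (X : normedModType R) (u : nat -> X) (x : X) :
  weak_cvg u x <->
  forall f : dual X, dual_pairing f (u k) @[k --> \oo] --> dual_pairing f x.
Proof.
split=> [ux f|ux].
  move=> C /(@initial_continuous X R (dual_pairing f) x) fxC.
  exact: (cvg_sup _ _ (fmap_filter _ _)).1 ux f _ fxC.
apply/cvg_sup => f B /= [_ [[C oC <-] /= Cx sCB]].
apply: (filterS sCB).
exact: (ux f C (open_nbhs_nbhs (conj oC Cx))).
Qed.

Definition pseudomonotone (R : realType) (X : normedModType R)
    (T : X -> dual X) : Prop :=
  forall (u : nat -> X) (x : X), weak_cvg u x ->
    (limn_esup (fun k => (dual_pairing (T (u k)) (u k - x))%:E) <= 0)%E ->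
    forall y : X,
      ((dual_pairing (T x) (x - y))%:E
       <= limn_einf (fun k => (dual_pairing (T (u k)) (u k - y))%:E))%E.

Definition mosco_cvg (R : realType) (X : normedModType R)
    (S_ : nat -> set X) (S : set X) : Prop :=
  (forall y, S y ->
     exists2 v : nat -> X, (forall k, S_ k (v k)) & v @ \oo --> y) /\
  (forall (v : nat -> X) (y : X), (forall k, S_ k (v k)) ->
     (exists2 s : nat -> nat, {homo s : m n / (m < n)%N} & weak_cvg (v \o s) y) ->
     S y).

Definition weakly_mosco_continuous (R : realType) (X : normedModType R)
    (Phi : X -> set X) : Prop :=
  forall (u : nat -> X) (x : X), weak_cvg u x -> mosco_cvg (Phi \o u) (Phi x).

Definition tangent_cone (R : realType) (X : normedModType R)
    (S : set X) (z : X) : set X :=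
  [set d | exists (u : nat -> X) (t : nat -> R),
     [/\ forall k, S (u k), u @ \oo --> z,
         forall k, 0 < t k, t @ \oo --> (0 : R) &
         (t k)^-1 *: (u k - z) @[k --> \oo] --> d]].

Definition qvi_solution (R : realType) (X : normedModType R)
    (F : X -> dual X) (Phi : X -> set X) (x : X) : Prop :=
  Phi x x /\ forall d, tangent_cone (Phi x) x d -> 0 <= dual_pairing (F x) d.

(* Main.v *)
(* If no point of [A] solves the problem, each [x] in [A] is refuted either by a functional
   separating [x] from [Phi x], or by some [y] in [Phi x] with [F x (x - y) > 0]; weak Mosco
   continuity and pseudomonotonicity propagate the refutation to a weak neighbourhood of [x].
   Since all hypotheses are sequential, the argument runs inside a closed convex set
   [B <= A], the closure of a countable set [d], where weak convergence is detected by
   countably many functionals, and which is saturated so that refuting [y]'s exist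
   (approximately) in [B].  A finite cover with weights merges the refutations into one form
   [pot x (y - x)].  Galerkin points [x_n] in the convex hull of [d_0, ..., d_n] with
   [pot x_n (d_i - x_n) <= 0] have a weak limit [x] with [pot x (y - x) <= 0] on [B], by the
   pseudomonotonicity of [F] (Brezis-Nirenberg-Stampacchia), contradicting the refutation
   of [x].

   Galerkin points come from a Sperner-type lemma for linear orders (Scarf), proved by a
   parity count, which avoids triangulations and Brouwer's theorem. *)

From mathcomp Require Import all_boot.
From mathcomp Require Import zify.

Set Implicit Arguments.
Unset Strict Implicit.
Unset Printing Implicit Defensive.

(** * Scarf's lemma for linear orders *)

(** The refutations can be merged into one form because each tolerates a change of test point. A
    separating functional is positive at [v - x] for every [v] in [Phi x], and all centres that
    refute through the variational inequality do so with the same functional [F x]; hence a single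
    [y] in [Phi x] contradicts all of them at once. No selection of [Phi] and no fixed point theorem
    for set-valued maps is involved. The restriction to [B] has a price: the limit inequality is
    known only against points of [B], while [y] may lie outside. As only finitely many refutations
    are active, they have a common margin, so a point of [B] close to [Phi x], with [F] almost as
    favourable as at [y], is enough; this is what saturation provides. The weights depend on
    finitely many functionals, so they pass to weak limits. The total weight in front of [F] may
    however tend to zero, and then pseudomonotonicity gives no information; in that case boundedness
    of [F] removes the term. *)

Lemma odd_facets (U I : finType) (f : U -> I) (i0 : I) (Z : {set U}) :
  #|Z| = #|I| ->
  odd #|[set z in Z | f @: (Z :\ z) == [set~ i0]]| = (f @: Z == setT).
Proof.
move=> cZ; have [fZ|fZ] := eqVneq (f @: Z) setT.
  have finj : {in Z &, injective f}.
    by apply/imset_injP; rewrite fZ cardsT cZ.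
  have /imsetP[z zZ fz] : i0 \in f @: Z by rewrite fZ inE.
  suff -> : [set z in Z | f @: (Z :\ z) == [set~ i0]] = [set z] by rewrite cards1.
  apply/setP => y; rewrite !inE; apply/andP/eqP => [[yZ /eqP fy]|->].
    apply: finj => //; apply/eqP; rewrite -fz.
    have : i0 \notin f @: (Z :\ y) by rewrite fy !inE eqxx.
    apply: contraNT => ne; apply/imsetP; exists z => //.
    by rewrite !inE zZ andbT; apply: contra ne => /eqP <-; rewrite fz.
  split=> //; apply/eqP/setP => i; rewrite !inE.
  apply/imsetP/idP => [[x]|ii0].
    rewrite !inE => /andP[xz xZ] ->; apply: contra xz => /eqP fx.
    by apply/eqP/finj => //; rewrite fx.
  have /imsetP[x xZ fx] : i \in f @: Z by rewrite fZ inE.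
  exists x => //; rewrite !inE xZ andbT; apply: contra ii0 => /eqP xz.
  by rewrite fx xz -fz.
(* Otherwise good facets come in pairs: if [Z :\ z] is one, exactly one other vertex [z'] shares the
   colour of [z], and dropping [z'] is the only alternative. *)
case: (set_0Vmem [set z in Z | f @: (Z :\ z) == [set~ i0]]) => [->|[z]].
  by rewrite cards0.
rewrite !inE => /andP[zZ /eqP fz].
have cC : #|[set~ i0]| = #|Z :\ z|.
  by rewrite cardsC1 -cZ (cardsD1 z Z) zZ.
have finj : {in Z :\ z &, injective f} by apply/imset_injP; rewrite fz cC.
have fzi : f z != i0.
  apply: contra fZ => /eqP fzi; apply/eqP.
  rewrite -(setD1K zZ) imsetU1 fz fzi.
  by apply/setP => i; rewrite !inE; case: eqP.
have /imsetP[z' z'Z fz'] : f z \in f @: (Z :\ z) by rewrite fz !inE.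
have zz' : z != z' by move: z'Z; rewrite !inE eq_sym => /andP[].
suff -> : [set z in Z | f @: (Z :\ z) == [set~ i0]] = [set z; z'].
  by rewrite cards2 zz'.
apply/setP => y; rewrite !inE; apply/andP/orP => [[yZ /eqP fy]|].
  have [->|yz] := eqVneq y z; first by left.
  right; apply/eqP.
  have /imsetP[w] : f y \in f @: (Z :\ y).
    have : f y \in f @: (Z :\ z) by apply: imset_f; rewrite !inE yz.
    by rewrite fz fy.
  rewrite !inE => /andP[wy wZ] fyw.
  have [wz|wz] := eqVneq w z.
    apply: finj => //; first by rewrite !inE yz.
    by rewrite fyw wz fz'.
  have : y = w by apply: finj; rewrite ?inE ?yz ?wz.
  by move=> yw; rewrite yw eqxx in wy.
case=> /eqP ->; first by rewrite zZ fz.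
have := z'Z; rewrite !inE => /andP[_ z'Z2]; split=> //.
rewrite -fz; apply/eqP/setP => i; apply/imsetP/imsetP => -[x].
  rewrite !inE => /andP[xz' xZ] ->.
  have [->|xz] := eqVneq x z; first by exists z'.
  by exists x => //; rewrite !inE xz.
rewrite !inE => /andP[xz xZ] ->.
have [->|xz'] := eqVneq x z'; first by exists z; rewrite // !inE zz'.
by exists x => //; rewrite !inE xz'.
Qed.

Section Scarf.
(* [s i] is a slack element, least for the order [i] and above all proper elements for the
   other orders; it plays the part of the facet [i] of a simplex. *)
Variables (U I : finType) (r : I -> U -> nat) (s : I -> U) (u0 : U).
Hypothesis r_inj : forall i, injective (r i).
Hypothesis s_min : forall i u, r i (s i) <= r i u.
Hypothesis s_big : forall i j u, j != i -> (forall k, u != s k) -> r i u < r i (s j).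
Hypothesis u0s : forall k, u0 != s k.

(** Scarf's primitive sets and their faces: no [y] is strictly above the minimum of [Z] in every
    order. They replace the simplices of a triangulation. *)
Definition dominated (Z : {set U}) :=
  [forall y, exists i, [forall z in Z, r i y <= r i z]].

Lemma dominatedP (Z : {set U}) :
  reflect (forall y, exists i, forall z, z \in Z -> r i y <= r i z) (dominated Z).
Proof.
apply: (iffP forallP) => h y.
  by have /existsP[i /forall_inP hi] := h y; exists i.
by have [i hi] := h y; apply/existsP; exists i; apply/forall_inP.
Qed.

Lemma dominated_sub (Z T : {set U}) : T \subset Z -> dominated Z -> dominated T.
Proof.
move=> /fintype.subsetP TZ /dominatedP dZ; apply/dominatedP => y.
by have [i hi] := dZ y; exists i => z /TZ; exact: hi.
Qed.

Lemma s_inj : injective s.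
Proof.
move=> i j sij; apply/eqP/negP => /negP; rewrite eq_sym => ij.
have := s_big ij u0s; rewrite -sij => h.
by have := s_min i u0; rewrite leqNgt h.
Qed.

Let m (T : {set U}) i :=
  if [pick u in T] is Some x0 then [arg min_(x < x0 in T) r i x] else s i.

Let mP (T : {set U}) i : T != set0 ->
  m T i \in T /\ forall z, z \in T -> r i (m T i) <= r i z.
Proof.
move=> /set0Pn[x xT]; rewrite /m; case: pickP => [x0 x0T|/(_ x)]; last by rewrite xT.
by case: arg_minnP.
Qed.

(** Domination applied to a vertex [z] of [T] itself yields an order in which [z] is the minimum. *)
Let m_surj (T : {set U}) : T != set0 -> dominated T -> m T @: setT = T.
Proof.
move=> T0 /dominatedP dT; apply/setP => z; apply/imsetP/idP.
  by move=> [i _ ->]; case: (mP i T0).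
move=> zT; have [i hi] := dT z; exists i => //.
have [mT mmin] := mP i T0; apply: (r_inj (i := i)).
by apply/eqP; rewrite eqn_leq hi// mmin.
Qed.

(* The vertices that may be added to the wall [T] when the order [k] becomes free. *)
Let M (T : {set U}) k := [set y | [forall l, (l != k) ==> (r l (m T l) < r l y)]].

(** [m T] maps [I] onto a set with one element less, so exactly one vertex is the minimum for two
    orders; only these two can be released without losing a vertex. *)
Let twins (T : {set U}) : #|T|.+1 = #|I| -> T != set0 -> dominated T ->
  exists i j, [/\ i != j, m T i = m T j,
    m T @: (setT :\ i) = T, m T @: (setT :\ j) = T &
    forall k, m T @: (setT :\ k) = T -> k = i \/ k = j].
Proof.
move=> cT T0 dT; have ms := m_surj T0 dT.
have : ~~ injectiveb (m T).
  apply/negP => /injectiveP mi.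
  have : #|m T @: setT| = #|[set: I]| by apply: card_imset.
  by rewrite ms cardsT -cT; lia.
move/injectivePn => [i [j ji mij]]; exists i, j.
have h (a b : I) : a != b -> m T a = m T b -> m T @: (setT :\ a) = T.
  move=> ab mab; rewrite -[RHS]ms; apply/setP => z.
  apply/imsetP/imsetP => -[x] xS ->; first by exists x.
  have [->|xa] := eqVneq x a; first by exists b; rewrite // !inE eq_sym ab.
  by exists x => //; rewrite !inE xa.
split=> //; first exact: h ji mij.
  by apply: h (esym mij); rewrite eq_sym.
move=> k mk; have [->|ki] := eqVneq k i; first by left.
have [->|kj] := eqVneq k j; first by right.
exfalso.
have h2 : m T @: (setT :\ k) = m T @: (setT :\ k :\ i).
  apply/setP => z; apply/imsetP/imsetP => -[x].
    rewrite !inE => /andP[xk _] ->; have [->|xi] := eqVneq x i.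
      by exists j; rewrite // !inE eq_sym ji eq_sym kj.
    by exists x; rewrite // !inE xi xk.
  by rewrite !inE => /and3P[xi xk _] ->; exists x => //; rewrite !inE xk.
have := leq_imset_card (m T) (setT :\ k :\ i).
rewrite -h2 mk.
have := cardsD1 k [set: I]; rewrite inE cardsT -cT.
have := cardsD1 i ([set: I] :\ k); rewrite !inE eq_sym ki/=.
by lia.
Qed.

(** The order that witnesses domination at [x] must be [k], since membership in [M T k] excludes all
    others. *)
Let M_low (T : {set U}) k x : dominated T -> T != set0 -> x \in M T k ->
  forall z, z \in T -> r k x <= r k z.
Proof.
move=> /dominatedP dT T0; rewrite inE => /forallP Mx.
have [i hi] := dT x; have [<-//|ik] := eqVneq i k.
have := Mx i; rewrite ik/= => lt.
by have := hi _ (mP i T0).1; rewrite leqNgt lt.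
Qed.

Let cell_wall (T : {set U}) x : #|T|.+1 = #|I| -> T != set0 ->
  x \notin T -> dominated (x |: T) ->
  exists2 k, m T @: (setT :\ k) = T &
    x \in M T k /\ forall y, y \in M T k -> r k y <= r k x.
Proof.
move=> cT T0 xT dZ; set Z := x |: T.
have Z0 : Z != set0 by apply/set0Pn; exists x; rewrite !inE eqxx.
have mZ := m_surj Z0 dZ.
have cZ : #|Z| = #|I| by rewrite cardsU1 xT -cT.
have mi : injective (m Z).
  have mi : {in [set: I] &, injective (m Z)} by apply/imset_injP; rewrite mZ cardsT cZ.
  by move=> a b; apply: mi; rewrite inE.
have /imsetP[k _ xk] : x \in m Z @: setT by rewrite mZ !inE eqxx.
have mTZ l : l != k -> m T l = m Z l.
  move=> lk; have [mT Tmin] := mP l T0; have [mZ1 Zmin] := mP l Z0.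
  have mT2 : m Z l \in T.
    move: mZ1; rewrite !inE => /orP[/eqP|//].
    by rewrite xk => /mi /eqP; rewrite (negbTE lk).
  by apply: (r_inj (i := l)); apply/eqP; rewrite eqn_leq Tmin// Zmin// !inE mT orbT.
exists k.
  apply/setP => z; apply/imsetP/idP => [[l _ ->]|zT]; first by case: (mP l T0).
  have /imsetP[l _ zl] : z \in m Z @: setT by rewrite mZ !inE zT orbT.
  have lk : l != k.
    by apply: contra xT => /eqP lk; rewrite xk -lk -zl.
  by exists l; rewrite ?inE ?lk// mTZ.
split.
  rewrite inE; apply/forallP => l; apply/implyP => lk; rewrite mTZ// ltn_neqAle.
  rewrite (mP l Z0).2 ?inE ?eqxx// andbT.
  apply: contra lk => /eqP /r_inj; rewrite [in RHS]xk => /mi ->; exact: eqxx.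
move=> y; rewrite inE => /forallP yM; have /dominatedP/(_ y)[i hi] := dZ.
have [<-|ik] := eqVneq i k; first by apply: hi; rewrite !inE eqxx.
have := yM i; rewrite ik/= ltnNge hi// !inE.
by have [-> _] := mP i T0; rewrite orbT.
Qed.

Let wall_cell (T : {set U}) k x : T != set0 -> dominated T ->
  m T @: (setT :\ k) = T -> x \in M T k ->
  (forall y, y \in M T k -> r k y <= r k x) -> x \notin T /\ dominated (x |: T).
Proof.
move=> T0 dT mk xM xmax; have xlow := M_low dT T0 xM.
have /forallP xM2 : [forall l, (l != k) ==> (r l (m T l) < r l x)] by rewrite inE in xM.
split.
  apply/negP; rewrite -mk => /imsetP[l]; rewrite !inE => /andP[lk _] xl.
  by have := xM2 l; rewrite lk/= -xl ltnn.
apply/dominatedP => y; have [yM|] := boolP (y \in M T k).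
  exists k => z; rewrite !inE => /predU1P[->|zT]; first exact: xmax.
  exact: leq_trans (xmax _ yM) (xlow _ zT).
rewrite inE negb_forall => /existsP[l]; rewrite negb_imply -leqNgt => /andP[lk yl].
exists l => z; rewrite !inE => /predU1P[->|zT].
  by apply: leq_trans yl _; apply: ltnW; have := xM2 l; rewrite lk.
by apply: leq_trans yl _; apply: (mP l T0).2.
Qed.

(** Each of the two twin orders gives at most one completion, the top of its [M T k], and [M_low]
    keeps the two apart. *)
Let completions (T : {set U}) : #|T|.+1 = #|I| -> T != set0 -> dominated T ->
  exists i j, [/\ i != j, m T i = m T j,
    #|[set x | (x \notin T) && dominated (x |: T)]| = (M T i != set0) + (M T j != set0) &
    forall k, m T @: (setT :\ k) = T -> k = i \/ k = j].
Proof.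
move=> cT T0 dT; have [i [j [ij mij mi mj mk]]] := twins cT T0 dT.
exists i, j; split=> //.
pose top k := [set x in M T k | [forall y in M T k, r k y <= r k x]].
have topC k : #|top k| = (M T k != set0).
  case: (set_0Vmem (M T k)) => [M0|[x0 x0M]].
    by rewrite M0 eqxx; apply/eqP; rewrite cards_eq0; apply/eqP/setP => x; rewrite inE M0 inE.
  have -> : M T k != set0 by apply/set0Pn; exists x0.
  have [x xM xmax] := arg_maxnP (fun x => r k x) x0M.
  apply/eqP/cards1P; exists x; apply/setP => y; rewrite [LHS]inE [RHS]inE.
  apply/andP/eqP => [[yM /forall_inP ymax]|->].
    by apply: (r_inj (i := k)); apply/eqP; rewrite eqn_leq ymax// andbT; apply: xmax.
  by split=> //; apply/forall_inP => z zM; apply: xmax.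
rewrite -!topC -cardsUI.
have -> : top i :&: top j = set0.
  apply/setP => x; rewrite in_set0; apply/negP; rewrite in_setI !inE.
  move=> /andP[/andP[/forallP xi _] /andP[xj _]].
  have := xi j; rewrite eq_sym ij/= ltnNge (M_low (k := j) dT T0) ?inE//.
  by case: (mP j T0).
rewrite cards0 addn0; apply: eq_card => x; rewrite inE; apply/andP/setUP => [[xT dZ]|].
  have [k /mk [->|->] [xM xmax]] := cell_wall cT T0 xT dZ; [left|right];
  by rewrite inE xM; apply/forall_inP.
by case; rewrite inE => /andP[xM /forall_inP xmax];
  [exact: wall_cell mi xM xmax|exact: wall_cell mj xM xmax].
Qed.

Let slack_dominated k : dominated (s @: [set~ k]).
Proof.
apply/dominatedP => y; have [/existsP[l /eqP yl]|] := boolP [exists l, y == s l].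
  by exists l => z _; rewrite yl.
rewrite negb_exists => /forallP ys; exists k => _ /imsetP[l lk ->].
by apply/ltnW/s_big => //; move: lk; rewrite !inE.
Qed.

(** As for a triangulated simplex, an interior wall lies in two cells, because [s k] is always
    available in [M T k], and a boundary wall in one: [u0] is in [M T k], but [M T l] is empty for
    the other twin [l]. *)
Let wall_odd (T : {set U}) : #|T|.+1 = #|I| -> T != set0 -> dominated T ->
  odd #|[set x | (x \notin T) && dominated (x |: T)]| =
  [exists k, T == s @: [set~ k]].
Proof.
move=> cT T0 dT; have [i [j [ij mij -> mk]]] := completions cT T0 dT.
have [/existsP[k /eqP Tk]|] := boolP [exists k, T == s @: [set~ k]].
  have mTs l : l != k -> m T l = s l.
    move=> lk; apply: (r_inj (i := l)); apply/eqP; rewrite eqn_leq s_min andbT.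
    by apply: (mP l T0).2; rewrite Tk; apply: imset_f; rewrite !inE.
  have Mk : M T k != set0.
    apply/set0Pn; exists u0; rewrite inE; apply/forallP => l; apply/implyP => lk.
    rewrite mTs// ltn_neqAle s_min andbT; apply/eqP => /r_inj e.
    by have := u0s l; rewrite -e eqxx.
  have mTk : m T @: (setT :\ k) = T.
    rewrite [RHS]Tk; apply/setP => z; apply/imsetP/imsetP => -[l lk ->];
    by rewrite !inE ?andbT in lk; exists l; rewrite ?mTs// !inE ?lk.
  have Mj0 l : l != k -> m T l = m T k -> M T l = set0.
    move=> lk mlk; apply/setP => y; rewrite inE in_set0; apply/negP => /forallP yM.
    have := yM k; rewrite eq_sym lk/= -mlk mTs// => ylt.
    have [/existsP[a /eqP ya]|] := boolP [exists a, y == s a]; last first.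
      rewrite negb_exists => /forallP ys.
      by have := s_big lk ys; rewrite ltnNge (ltnW ylt).
    have [al|al] := eqVneq a l; first by rewrite ya al ltnn in ylt.
    have [ak|ak] := eqVneq a k; first by rewrite ya ak ltnNge s_min in ylt.
    by have := yM a; rewrite al/= mTs// ya ltnn.
  case: (mk k mTk) => e; rewrite -e in mij ij *.
    by rewrite Mk Mj0 ?eqxx// eq_sym.
  by rewrite Mk Mj0 ?eqxx.
rewrite negb_exists => /forallP nT.
suff Mn k : M T k != set0 by rewrite !Mn.
apply/set0Pn; exists (s k); rewrite inE; apply/forallP => l; apply/implyP => lk.
have [mT mmin] := mP l T0.
have [/existsP[a /eqP ma]|] := boolP [exists a, m T l == s a]; last first.
  by rewrite negb_exists => /forallP ms; apply: s_big; rewrite // eq_sym.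
have [al|al] := eqVneq a l.
  rewrite ma al ltn_neqAle s_min andbT; apply/eqP => /r_inj/s_inj e.
  by rewrite e eqxx in lk.
exfalso; have /eqP[] := nT l; apply/eqP; rewrite eqEcard; apply/andP; split; last first.
  rewrite card_imset; last exact: s_inj.
  by rewrite cardsC1 -cT.
apply/subsetP => z zT; have := mmin _ zT; rewrite ma.
have [/existsP[b /eqP ->]|] := boolP [exists b, z == s b]; last first.
  rewrite negb_exists => /forallP zs.
  by have := s_big al zs; rewrite ltnNge => /negbTE ->.
move=> le; apply: imset_f; rewrite !inE; apply/eqP => bl; rewrite bl in le.
have : s a = s l by apply: (r_inj (i := l)); apply/eqP; rewrite eqn_leq le s_min.
by move=> /s_inj /eqP; rewrite (negbTE al).
Qed.

Variables (f : U -> I) (i0 : I).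
Hypothesis fs : forall i, f (s i) = i.

Lemma dominated_rainbow :
  exists2 Z : {set U}, dominated Z & f @: Z = setT.
Proof.
(* With a single order the walls would be empty; a maximal element alone is then the cell. *)
have [I1|I1] := eqVneq #|I| 1.
  have [x _ xmax] := arg_maxnP (fun x => r i0 x) (isT : predT u0).
  exists [set x].
    by apply/dominatedP => y; exists i0 => z; rewrite inE => /eqP ->; apply: xmax.
  have /fintype_le1P I_eq : #|I| <= 1 by rewrite I1.
  by apply/setP => i; rewrite imset_set1 !inE; apply/eqP; exact: I_eq.
have cI : 1 < #|I| by rewrite ltn_neqAle eq_sym I1; apply/card_gt0P; exists i0.
pose cell (Z : {set U}) := dominated Z && (#|Z| == #|I|).
pose cw (T : {set U}) := [&& dominated T, #|T|.+1 == #|I| & f @: T == [set~ i0]].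
suff [Z /andP[dZ _] fZ] : exists2 Z, cell Z & f @: Z == setT.
  by exists Z => //; apply/eqP.
apply/exists_inP; apply: contraT => /exists_inPn nZ.
(* Double count of the pairs of a cell and a facet coloured by [[set~ i0]]: without a rainbow cell
   every cell contributes an even number, yet the walls contribute an odd total. *)
have E : \sum_(Z | cell Z) \sum_(T | cw T && (T \subset Z)) 1 =
         \sum_(T | cw T) \sum_(Z | cell Z && (T \subset Z)) 1.
  rewrite (exchange_big_dep cw)/=; last by move=> Z T _ /andP[].
  by apply: eq_bigr => T cT; apply: eq_bigl => Z; rewrite cT.
have oddsum (P : pred {set U}) (h : {set U} -> nat) :
    odd (\sum_(Z | P Z) h Z) = odd (\sum_(Z | P Z) odd (h Z)).
  by elim/big_rec2 : _ => // Z a b _; rewrite !oddD => ->; rewrite oddb.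
have L : ~~ odd (\sum_(Z | cell Z) \sum_(T | cw T && (T \subset Z)) 1).
  rewrite oddsum big1// => Z cZ; have /andP[dZ /eqP cZ2] := cZ.
  have -> : \sum_(T | cw T && (T \subset Z)) 1 =
      #|[set z in Z | f @: (Z :\ z) == [set~ i0]]|.
    rewrite sum1_card -[RHS](card_in_imset (f := fun z => Z :\ z)); last first.
      move=> x y; rewrite !inE => /andP[xZ _] /andP[yZ _] xy.
      have : x \notin Z :\ y by rewrite -xy !inE eqxx.
      by rewrite !inE xZ andbT negbK => /eqP.
    rewrite -[LHS]cardsE; apply: eq_card => T; rewrite inE.
    apply/andP/imsetP => [[/and3P[dT /eqP cT fT] TZ]|[z]].
      have /eqP/cards1P[z Tz] : #|Z :\: T| = 1.
        by have := cardsID T Z; rewrite (setIidPr TZ) cZ2 -cT; lia.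
      have zZ : z \in Z by have := set11 z; rewrite -Tz inE => /andP[].
      have TE : T = Z :\ z by rewrite -Tz setDDr setDv set0U; apply/esym/setIidPr.
      by exists z => //; rewrite inE zZ -TE.
    rewrite inE => /andP[zZ fz] ->; rewrite subsetDl; split=> //.
    rewrite /cw fz andbT (dominated_sub _ dZ) ?subsetDl//=.
    by rewrite -cZ2 (cardsD1 z Z) zZ.
  by rewrite odd_facets// (negbTE (nZ _ cZ)).
move: L; rewrite E oddsum.
have cw0 : cw (s @: [set~ i0]).
  rewrite /cw slack_dominated card_imset; last exact: s_inj.
  rewrite cardsC1 prednK ?eqxx/=; last by apply: ltnW.
  apply/eqP/setP => i; apply/imsetP/idP => [[_ /imsetP[l li ->] ->]|ii]; first by rewrite fs.
  by exists (s i); rewrite ?fs//; apply: imset_f.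
(* By [fs], the only boundary wall with the colours [[set~ i0]] is [s @: [set~ i0]]. *)
have fib T : cw T ->
    odd (\sum_(Z | cell Z && (T \subset Z)) 1) = (T == s @: [set~ i0]).
  move=> /and3P[dT /eqP cT /eqP fT].
  have T0 : T != set0 by apply: contraTneq cI => T0; rewrite -cT T0 cards0.
  have -> : \sum_(Z | cell Z && (T \subset Z)) 1 =
      #|[set x | (x \notin T) && dominated (x |: T)]|.
    rewrite sum1_card -[RHS](card_in_imset (f := fun x => x |: T)); last first.
      move=> x y; rewrite !inE => /andP[xT _] /andP[yT _] xy.
      have : x \in y |: T by rewrite -xy !inE eqxx.
      by rewrite !inE (negbTE xT) orbF => /eqP.
    rewrite -[LHS]cardsE; apply: eq_card => Z; rewrite inE.
    apply/andP/imsetP => [[/andP[dZ /eqP cZ] TZ]|[x]].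
      have /eqP/cards1P[x Zx] : #|Z :\: T| = 1.
        by have := cardsID T Z; rewrite (setIidPr TZ) cZ -cT; lia.
      have ZE : Z = x |: T by rewrite -Zx setUC -[LHS](setID Z T) (setIidPr TZ).
      exists x => //; rewrite inE -ZE dZ andbT.
      by have := set11 x; rewrite -Zx inE => /andP[].
    by rewrite inE => /andP[xT dZ] ->; rewrite /cell dZ cardsU1 xT -cT eqxx subsetUr.
  rewrite wall_odd//; apply/existsP/eqP => [[k /eqP Tk]|->]; last by exists i0.
  suff -> : i0 = k by [].
  apply/eqP; apply: contraT => ik.
  have : i0 \in f @: T by rewrite Tk -[X in X \in _]fs !imset_f// !inE.
  by rewrite fT !inE eqxx.
rewrite (bigD1 (s @: [set~ i0]) cw0)/=.
rewrite fib// eqxx big1; first by [].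
by move=> T /andP[cT /negbTE T0]; rewrite fib// T0.
Qed.

End Scarf.

(* The orders are the coordinates on the grid [\sum_i x i = N], with ties broken by
   [enum_rank]; dominance bounds the diameter of the chosen set of grid points. *)
Lemma grid_rainbow (I : finType) (N : nat) (c : {ffun I -> nat} -> I) :
  exists (w : {ffun I -> nat}) (z : I -> {ffun I -> nat}),
  [/\ \sum_i w i = N, forall i, \sum_j z i j = N,
      forall i j, z i j <= w j + #|I| /\ w j <= z i j + #|I| &
      forall i, w i <= #|I| \/ c (z i) = i].
Proof.
pose i0 := c [ffun=> 0].
pose V : finType := {x : {ffun I -> 'I_N.+1} | \sum_i x i == N}.
have mkV (x : I -> nat) : \sum_i x i = N -> exists v : V, forall i, sval v i = x i :> nat.
  move=> xN; have xle i : x i < N.+1 by rewrite -xN ltnS (bigD1 i)//= leq_addr.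
  pose xv := [ffun i => Ordinal (xle i)] : {ffun I -> 'I_N.+1}.
  have xP : \sum_i xv i == N.
    by rewrite -[X in _ == X]xN; apply/eqP/eq_bigr => i _; rewrite ffunE.
  by exists (exist _ xv xP) => i; rewrite /= ffunE.
have spike (x : I -> nat) i : \sum_(j | j != i) x j <= N ->
    \sum_j (if j == i then N - \sum_(j | j != i) x j else x j) = N.
  move=> h; rewrite (bigD1 i)//= eqxx -[RHS](subnK h); congr (_ + _).
  by apply: eq_bigr => j /negbTE ->.
pose K := #|V|.+1.
pose rho i (v : V) := sval v i * K + enum_rank v.
have rhoK i v : rho i v %/ K = sval v i.
  by rewrite /rho divnMDl// divn_small ?addn0// ltnS ltnW// ltn_ord.
have rho_inj i : injective (rho i).
  move=> u v uv; have e := rhoK i u; rewrite uv rhoK in e.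
  by move/eqP: uv; rewrite /rho e eqn_add2l => /eqP/val_inj/enum_rank_inj.
have rho_le i u v : rho i u <= rho i v -> sval u i <= sval v i.
  by move=> h; rewrite -!rhoK; apply: leq_div2r.
pose B := (N.+1 * K).+1.
have rhoB i v : (rho i v).+1 < B.
  rewrite ltnS /rho mulSn addnC; apply: leq_trans (_ : K + N * K <= _) => //.
  rewrite -addSn leq_add//; first by rewrite ltnS ltnW ?ltn_ord.
  by rewrite leq_mul// -ltnS ltn_ord.
pose r i (u : V + I) := match u with
  | inl v => (rho i v).+1 | inr j => if j == i then 0 else B + enum_rank j end.
have [v0 _] : exists v : V, forall i, sval v i = (if i == i0 then N else 0) :> nat.
  apply: mkV; rewrite (bigD1 i0)//= eqxx big1 ?addn0// => j /negbTE ->//.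
pose f (u : V + I) := match u with
  | inl v => c [ffun i => sval v i : nat] | inr j => j end.
have [] := @dominated_rainbow _ I r inr (inl v0) _ _ _ _ f i0.
- move=> i [u|j] [v|k] /=.
  + by move=> [/rho_inj ->].
  + case: eqP => // _ e; have := rhoB i u; rewrite e; lia.
  + case: eqP => // _ e; have := rhoB i v; rewrite -e; lia.
  + case: eqP => [->|_]; case: eqP => [->|_] //.
    by move/eqP; rewrite eqn_add2l => /eqP/val_inj/enum_rank_inj ->.
- by move=> i u /=; rewrite eqxx.
- move=> i j [v|k] /negbTE ij /= h; first by rewrite ij; have := rhoB i v; lia.
  by have := h k; rewrite eqxx.
- by [].
- by [].
move=> Z /dominatedP dZ fZ.
pose C := [set i | inr i \notin Z].
have dC (y : V) : exists2 i, i \in C & forall v, inl v \in Z -> sval y i <= sval v i.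
  have [i hi] := dZ (inl y); exists i.
    by rewrite inE; apply/negP => /hi /=; rewrite eqxx.
  by move=> v /hi /= h; apply: rho_le; rewrite -ltnS.
have col i : i \in C -> exists2 v : V, inl v \in Z & c [ffun j => sval v j : nat] = i.
  move=> iC; have /imsetP[[v|j] uZ e] : i \in f @: Z by rewrite fZ inE.
    by exists v.
  by move: iC; rewrite inE e /= uZ.
have [k kC _] := dC v0; have [w wZ wk] := col k kC.
pose S := [set v : V | inl v \in Z].
have wS : w \in S by rewrite inE.
pose mn i := sval [arg min_(v < w in S) sval v i] i : nat.
have mn_le i v : v \in S -> mn i <= sval v i.
  by move=> vS; rewrite /mn; case: arg_minnP => // u _; apply.
(* Otherwise some grid point exceeds every minimum [mn i] with [i] in [C], the surplus being put on
   coordinate [k], and it would not be dominated. Hence the coordinates in [C] leave less than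
   [#|C|] to share above the minima, which bounds the diameter. *)
have big : N < \sum_(i in C) (mn i).+1.
  rewrite ltnNge; apply/negP => le.
  pose x i := if i \in C then (mn i).+1 else 0.
  have xC : \sum_i x i = \sum_(i in C) (mn i).+1 by rewrite [RHS]big_mkcond.
  have xk : \sum_(j | j != k) x j <= N.
    by apply: leq_trans le; rewrite -xC [in leqRHS](bigD1 k)//= leq_addl.
  have [y yE] := mkV _ (spike x k xk); have [i iC hi] := dC y.
  have yi : mn i < sval y i.
    have xi : x i = (mn i).+1 by rewrite /x iC.
    rewrite yE; case: eqP => [ik|_]; last by rewrite xi.
    by rewrite -xi ik leq_subRL// addnC -[X in X <= _](bigD1 k (P := predT)) ?xC.
  move: yi; rewrite /mn; case: arg_minnP => // u; rewrite inE => uZ _.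
  by rewrite ltnNge hi.
have sumC v : v \in S -> \sum_(i in C) (sval v i - mn i) + \sum_(i | i \notin C) sval v i <= #|I|.
  move=> vS; have /eqP vN := svalP v; rewrite (bigID (mem C))/= in vN.
  have e : \sum_(i in C) (sval v i - mn i) + \sum_(i in C) mn i = \sum_(i in C) sval v i.
    by rewrite -big_split/=; apply: eq_bigr => i _; rewrite subnK// mn_le.
  have e2 : \sum_(i in C) (mn i).+1 = \sum_(i in C) mn i + #|C|.
    by rewrite -sum1_card -big_split/=; apply: eq_bigr => i _; rewrite addn1.
  have cCI : #|C| <= #|I| by exact: max_card.
  move: vN e e2 big cCI; do 5!move: (\sum_(_ | _) _) => ?.
  move: #|C| #|I| => ? ?.
  by lia.
have near v i : v \in S -> if i \in C then sval v i <= mn i + #|I| else sval v i <= #|I|.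
  move=> vS; have := sumC v vS; case: ifPn => iC.
    by rewrite (bigD1 i)//=; have := mn_le i v vS; lia.
  by rewrite [X in _ + X](bigD1 i)//=; lia.
(* The default [w] serves the indices outside [C], where the conclusion is [w i <= #|I|] and no
   colour is required. *)
pose pk i : V := if [pick v in S | c [ffun j => sval v j : nat] == i] is Some v then v else w.
have pkS i : pk i \in S by rewrite /pk; case: pickP => // v /andP[].
have fE (v : V) : \sum_j [ffun j => sval v j : nat] j = N.
  by rewrite -[RHS](eqP (svalP v)); apply: eq_bigr => j _; rewrite ffunE.
exists [ffun j => sval w j : nat], (fun i => [ffun j => sval (pk i) j : nat]); split.
- exact: fE.
- by move=> i; exact: fE.
- move=> i j; rewrite !ffunE.
  have := near _ j (pkS i); have := near _ j wS.
  have := mn_le j _ (pkS i); have := mn_le j _ wS.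
  by case: ifP => _; lia.
- move=> i; rewrite ffunE; have [iC|iC] := boolP (i \in C); last first.
    by left; have := near _ i wS; rewrite (negbTE iC).
  right; have [v vZ vi] := col i iC; rewrite /pk; case: pickP => [u /andP[_ /eqP//]|/(_ v)].
  by rewrite inE vZ vi eqxx.
Qed.

Require Import Defs.
From HB Require Import structures.
From mathcomp Require Import all_order all_algebra.
From mathcomp Require Import all_classical all_reals all_analysis.
From mathcomp Require Import ring lra.
Import Order.TTheory GRing.Theory Num.Theory.
Import numFieldNormedType.Exports.
Local Open Scope classical_set_scope.
Local Open Scope ring_scope.

(** * Complementarity on the simplex *)

Lemma extraction (P : nat -> nat -> Prop) :
  (forall j N, exists2 k, (N <= k)%N & P j k) ->
  exists2 s : nat -> nat, {homo s : m n / (m < n)%N} & forall j, P j (s j).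
Proof.
move=> h; have /choice[f hf] : forall jN : nat * nat, exists k, (jN.2 <= k)%N /\ P jN.1 k.
  by move=> [j N]; have [k] := h j N; exists k.
pose fix s j := if j is j'.+1 then f (j, (s j').+1) else f (0%N, 0%N).
exists s; first by apply: homo_ltn => [? ? ?|j /=]; [exact: ltn_trans|case: (hf (j.+1, (s j).+1))].
by case=> [|j] /=; [case: (hf (0, 0)%N)|case: (hf (j.+1, (s j).+1))].
Qed.

Lemma leq_extraction (s : nat -> nat) : {homo s : m n / (m < n)%N} ->
  forall k, (k <= s k)%N.
Proof. by move=> hs; elim=> // k /leq_ltn_trans; apply; exact: hs. Qed.

Lemma cvg_extraction (s : nat -> nat) : {homo s : m n / (m < n)%N} -> s @ \oo --> \oo.
Proof.
move=> hs P [N _ NP]; exists N => // k /= Nk; apply: NP => /=.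
exact: leq_trans Nk (leq_extraction hs k).
Qed.

Lemma cvg_subseq (T : topologicalType) (u : nat -> T) (s : nat -> nat) (F : set_system T) :
  {homo s : m n / (m < n)%N} -> u @ \oo --> F -> (u \o s) @ \oo --> F.
Proof. by move=> /cvg_extraction hs hu; apply: cvg_comp hs hu. Qed.

Lemma cvgn0 (R : realType) (T : normedModType R) (u : nat -> T) (l : T) (a : R) :
  (forall k, `|u k - l| <= a / k.+1%:R) -> u @ \oo --> l.
Proof.
move=> h; apply/cvgrPdist_le => e e0.
have /(cvgMl_tmp (a := a)) : harmonic x @[x --> \oo] --> (0 : R) by exact: cvg_harmonic.
rewrite mulr0 => /cvgr0_norm_le - /(_ _ e0).
apply: filterS => k hk; rewrite distrC; apply: le_trans (h k) _.
by apply: le_trans (ler_norm _) hk.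
Qed.

Definition simplex (R : realType) n (l : 'I_n -> R) :=
  (forall i, 0 <= l i) /\ \sum_i l i = 1.

Lemma simplex_subseq (R : realType) n (l : nat -> 'I_n -> R) :
  (forall k, simplex (l k)) ->
  exists2 s : nat -> nat, {homo s : m n / (m < n)%N} &
  exists2 l0, simplex l0 & forall i, l (s k) i @[k --> \oo] --> l0 i.
Proof.
move=> hl; pose v k : 'rV[R]_n := \row_i l k i.
have cI : compact [set v : 'rV[R]_n | forall i, v ord0 i \in `[0, 1] ].
  apply: (@rV_compact _ _ (fun=> `[(0 : R), 1]%classic)).
  by move=> _; apply: segment_compact.
have [|l0 [_ hc]] := cI (v @ \oo) _.
  exists 0%N => // k _ i; rewrite !mxE in_itv/=; have [h0 h1] := hl k.
  by rewrite h0 -h1 (bigD1 i)//= lerDl sumr_ge0.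
have [j N|s hs hv] := @extraction (fun j k => forall i, `|l k i - l0 0 i| <= 1 / j.+1%:R).
  have j0 : 0 < 1 / j.+1%:R :> R by rewrite divr_gt0.
  have vN : (v @ \oo) (v @` [set k | (N <= k)%N]) by exists N => // k /= Nk; exists k.
  have [_ [[k /= Nk <-] [_ vk]]] := hc _ _ vN (nbhsx_ballx l0 _ j0).
  by exists k => // i; have := vk ord0 i; rewrite !mxE /ball/= => /ltW; rewrite distrC.
have cl i : l (s k) i @[k --> \oo] --> l0 0 i.
  by apply: (@cvgn0 R R^o _ _ 1) => k; exact: hv.
exists s => //; exists (l0 0) => //; split => [i|].
  by apply: (cvgr_to_ge (cl i)); near=> k; case: (hl (s k)).
have : \sum_i l (s k) i @[k --> \oo] --> \sum_i l0 0 i.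
  by apply: cvg_big => //; exact: add_continuous.
under eq_fun do rewrite (hl _).2.
by move=> h; apply: (norm_cvg_unique h); exact: cvg_cst.
Unshelve. all: by end_near. Qed.

(* Grid points are coloured by the index of a largest [g i]; in the limit [l], every [i]
   with [l i > 0] maximises [g i l], so the maximum is at most the weighted mean. *)
Lemma simplex_complementarity (R : realType) n
    (g : 'I_n.+1 -> ('I_n.+1 -> R) -> R) :
  (forall (l : nat -> 'I_n.+1 -> R) l0, (forall k, simplex (l k)) -> simplex l0 ->
     (forall i, l k i @[k --> \oo] --> l0 i) ->
     forall i, g i (l k) @[k --> \oo] --> g i l0) ->
  (forall l, simplex l -> \sum_i l i * g i l <= 0) ->
  exists2 l, simplex l & forall i, g i l <= 0.
Proof.
move=> gc gs.
pose sc N (x : 'I_n.+1 -> nat) i : R := (x i)%:R / N.+1%:R.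
have scS N x : (\sum_i x i = N.+1)%N -> simplex (sc N x).
  move=> xN; split=> [i|]; first by rewrite divr_ge0.
  by rewrite -mulr_suml -natr_sum xN divff.
have amax (l : 'I_n.+1 -> R) : exists i, forall j, g j l <= g i l.
  have [i _ hi] := @arg_maxP _ _ _ (ord0 : 'I_n.+1) predT (fun i => g i l) isT.
  by exists i => j; exact: hi.
have /choice[top htop] := amax.
have /choice[wz hwz] : forall N, exists wz : {ffun 'I_n.+1 -> nat} * ('I_n.+1 -> {ffun 'I_n.+1 -> nat}),
  [/\ (\sum_i wz.1 i = N.+1)%N, forall i, (\sum_j wz.2 i j = N.+1)%N,
      forall i j, (wz.2 i j <= wz.1 j + n.+1)%N /\ (wz.1 j <= wz.2 i j + n.+1)%N &
      forall i, (wz.1 i <= n.+1)%N \/ top (sc N (wz.2 i)) = i].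
  move=> N; have [w [z]] := grid_rainbow N.+1 (fun x => top (sc N x)).
  by rewrite card_ord; exists (w, z).
pose w N := sc N (wz N).1; pose z N i := sc N ((wz N).2 i).
have wS N : simplex (w N) by apply: scS; case: (hwz N).
have zS N i : simplex (z N i) by apply: scS; case: (hwz N).
have [s hs [l0 l0S wl]] := simplex_subseq wS.
have zl i j : z (s k) i j @[k --> \oo] --> l0 j.
  have d0 : (z k i j - w k j) @[k --> \oo] --> (0 : R).
    apply: (@cvgn0 R R^o _ _ n.+1%:R) => k; rewrite subr0 /z /w /sc -mulrBl normrM.
    rewrite [X in _ * X]ger0_norm// ler_pM2r ?invr_gt0//.
    have [_ _ /(_ i j)[h1 h2] _] := hwz k.
    rewrite ler_norml lerBlDl -natrD ler_nat h1 andbT.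
    by rewrite lerNl opprB lerBlDl -natrD ler_nat.
  have -> : (fun k => z (s k) i j) = (fun k => z (s k) i j - w (s k) j + w (s k) j).
    by apply/funext => k; rewrite subrK.
  by rewrite -[l0 j]add0r; exact: cvgD (cvg_subseq hs d0) (wl j).
have gl i j : 0 < l0 i -> g j l0 <= g i l0.
  move=> li; rewrite -subr_ge0.
  have cz a := gc (fun k => z (s k) i) l0 (fun k => zS _ _) l0S (zl i) a.
  apply: (cvgr_to_ge (cvgB (cz i) (cz j))).
  (* A coordinate that stays above [l0 i / 2] eventually exceeds the grid error [n.+1 / N.+1], so
     the [i]-th nearby grid point really has colour [i]. *)
  have l2 : 0 < l0 i / 2 by rewrite divr_gt0.
  have w2 : \forall k \near \oo, l0 i / 2 < w (s k) i.
    by apply: (cvgr_gt (l0 i) (wl i)); lra.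
  have h0 : n.+1%:R / k.+1%:R @[k --> \oo] --> (0 : R).
    apply: (@cvgn0 R R^o _ _ n.+1%:R) => k; rewrite subr0 ger0_norm ?divr_ge0//.
  have h2 : \forall k \near \oo, n.+1%:R / (s k).+1%:R < l0 i / 2.
    exact: (cvgr_lt 0 (cvg_subseq hs h0)).
  near=> k.
  have lw : l0 i / 2 < w (s k) i by near: k.
  have lk : n.+1%:R / (s k).+1%:R < l0 i / 2 by near: k.
  have [_ _ _ /(_ i)[h|h]] := hwz (s k).
    have : w (s k) i <= n.+1%:R / (s k).+1%:R by rewrite ler_pM2r ?invr_gt0// ler_nat.
    by rewrite leNgt (lt_trans lk lw).
  by rewrite subr_ge0 /= -{2}h /z; exact: htop.
exists l0 => // j; have [l00 l01] := l0S.
apply: le_trans (gs _ l0S).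
rewrite -[leLHS]mul1r -l01 mulr_suml; apply: ler_sum => i _.
have := l00 i; rewrite le_eqVlt => /predU1P[<-|li]; first by rewrite !mul0r.
by rewrite ler_pM2l// gl.
Unshelve. all: by end_near. Qed.

(** * Hahn-Banach and separation *)

Section HahnBanach.
Variables (R : realType) (X : lmodType R).
Implicit Types (p q : X -> R) (x y : X) (t : R).

Definition sublinear p :=
  (forall x y, p (x + y) <= p x + p y) /\ (forall t x, 0 < t -> p (t *: x) <= t * p x).

Lemma sublinear0 p : sublinear p -> p 0 = 0.
Proof.
move=> [_ ph]; have := ph 2 0 ltac:(lra); have := ph (1 / 2) 0 ltac:(lra).
by rewrite !scaler0; lra.
Qed.

Lemma sublinearZ p t x : sublinear p -> 0 < t -> p (t *: x) = t * p x.
Proof.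
move=> [_ ph] t0; apply/eqP; rewrite eq_le ph//=.
have := ph t^-1 (t *: x); rewrite invr_gt0 => /(_ t0).
by rewrite scalerA mulVf ?gt_eqF// scale1r mulrC ler_pdivlMr// mulrC.
Qed.

Lemma sublinear_ge p x : sublinear p -> - p (- x) <= p x.
Proof. by move=> hp; have := hp.1 x (- x); rewrite subrr sublinear0//; lra. Qed.

Let tilt_set p y x := [set p (x + t *: y) - t * p y | t in [set t | 0 <= t]].
(** The largest values compatible with being linear along [y]: taking [t = 1] gives
    [tilt p y (- y) <= - p y], so a linear minorant of [tilt p y] attains [p] at [y]. *)
Definition tilt p y x := inf (tilt_set p y x).

Let tilt_lb p y x : sublinear p -> lbound (tilt_set p y x) (- p (- x)).
Proof.
move=> hp _ [t /= t0 <-]; have h : p (t *: y) = t * p y.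
  move: t0; rewrite le_eqVlt => /predU1P[<-|t0]; last exact: sublinearZ.
  by rewrite scale0r mul0r sublinear0.
by have := hp.1 (x + t *: y) (- x); rewrite addrAC subrr add0r h; lra.
Qed.

Let tilt_le p y x t : sublinear p -> 0 <= t -> tilt p y x <= p (x + t *: y) - t * p y.
Proof.
by move=> hp t0; apply: ge_inf; [exists (- p (- x)); exact: tilt_lb|exists t].
Qed.

Let tilt_adh p y x e : sublinear p -> 0 < e ->
  exists2 t, 0 <= t & p (x + t *: y) - t * p y < tilt p y x + e.
Proof.
move=> hp e0; have [|_ [t t0 <-]] := @inf_adherent _ (tilt_set p y x) _ e0; last by exists t.
by split; [exists (p (x + 0 *: y) - 0 * p y); exists 0 => /=|exists (- p (- x)); exact: tilt_lb].
Qed.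

Lemma tilt_sublinear p y : sublinear p -> sublinear (tilt p y).
Proof.
move=> hp; split=> [x x'|t x t0].
  apply/ler_addgt0Pl => e e0; have e2 : 0 < e / 2 by lra.
  have [s s0 hs] := tilt_adh y x hp e2; have [s' s0' hs'] := tilt_adh y x' hp e2.
  have := tilt_le y (x + x') hp (addr_ge0 s0 s0').
  have := hp.1 (x + s *: y) (x' + s' *: y).
  by rewrite scalerDl addrACA; lra.
apply/ler_addgt0Pl => e e0; have e2 : 0 < e / t by rewrite divr_gt0.
have [s s0 hs] := tilt_adh y x hp e2.
have := tilt_le y (t *: x) hp (mulr_ge0 (ltW t0) s0).
rewrite -scalerA -scalerDr (sublinearZ _ hp t0) -mulrA -mulrBr.
move/le_trans; apply.
have -> : e + t * tilt p y x = t * (tilt p y x + e / t) by field; rewrite gt_eqF.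
by rewrite ler_pM2l// ltW.
Qed.

Lemma tilt_self p y x : sublinear p -> tilt p y x <= p x.
Proof. by move=> hp; have := tilt_le y x hp (lexx 0); rewrite scale0r mul0r addr0 subr0. Qed.

(* Zorn: a minimal sublinear functional equals each of its tilts, hence is additive. *)
Lemma sublinear_minorant q : sublinear q ->
  exists f : {linear X -> R^o}, forall x, f x <= q x.
Proof.
move=> hq.
pose T := {p : X -> R | sublinear p /\ forall x, p x <= q x}.
pose t0 : T := exist _ q (conj hq (fun x => lexx _)).
pose r (s t : T) := `[< forall x, sval t x <= sval s x >].
have [||A Atot|[p [hp pq]] pmin] := @ZL_preorder T t0 r.
- by move=> t; apply/asboolP.
- by move=> s t u /asboolP h1 /asboolP h2; apply/asboolP => x; exact: le_trans (h2 x) (h1 x).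
- have [A0|A0] := pselect (A !=set0); last first.
    by exists t0 => s As; exfalso; apply: A0; exists s.
  pose E x := [set sval s x | s in A]; pose p x := inf (E x).
  have Elb x : lbound (E x) (- q (- x)).
    move=> _ [[s [hs sq]] _ <-] /=; apply: le_trans (sublinear_ge x hs).
    by rewrite lerN2.
  have p_le x (s : T) : A s -> p x <= sval s x.
    by move=> As; apply: ge_inf; [exists (- q (- x)); exact: Elb|exists s].
  have p_adh x e : 0 < e -> exists2 s, A s & sval s x < p x + e.
    move=> e0; have [|_ [s As <-]] := @inf_adherent _ (E x) _ e0; last by exists s.
    split; last by exists (- q (- x)); exact: Elb.
    by case: A0 => s As; exists (sval s x); exists s.
  have hp : sublinear p /\ forall x, p x <= q x.
    split; last first.
      by case: A0 => s As x; apply: le_trans (p_le x _ As) _; case: (s) => [? []].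
    split=> [x y|t x t0'].
      apply/ler_addgt0Pl => e e0; have e2 : 0 < e / 2 by lra.
      have [s As hs] := p_adh x _ e2; have [s' As' hs'] := p_adh y _ e2.
      (* The smaller of the two members is almost optimal at both points. *)
      have [/asboolP h|/asboolP h] := Atot _ _ As As'.
        have := p_le (x + y) _ As'; have := (svalP s').1.1 x y; have := h x; lra.
      have := p_le (x + y) _ As; have := (svalP s).1.1 x y; have := h y; lra.
    apply/ler_addgt0Pl => e e0; have e2 : 0 < e / t by rewrite divr_gt0.
    have [s As hs] := p_adh x _ e2.
    have := p_le (t *: x) _ As; rewrite (sublinearZ x (svalP s).1 t0').
    move/le_trans; apply.
    have -> : e + t * p x = t * (p x + e / t) by field; rewrite gt_eqF.
    by rewrite ler_pM2l// ltW.
  by exists (exist _ p hp) => s As; apply/asboolP => x; exact: p_le.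
have padd x y : p (x + y) = p x + p y.
  have hT : sublinear (tilt p y) /\ forall x, tilt p y x <= q x.
    by split=> [|z]; [exact: tilt_sublinear|exact: le_trans (tilt_self _ _ hp) (pq z)].
  have /asboolP/(_ x)/= := pmin (exist _ _ hT) (introT (asboolP _) (fun z => tilt_self y z hp)).
  have := tilt_le y x hp ler01; rewrite scale1r mul1r.
  by have := hp.1 x y; lra.
have p0 := sublinear0 hp.
have pN x : p (- x) = - p x by have := padd x (- x); rewrite subrr p0; lra.
have plin : linear (p : X -> R^o).
  move=> t x y; rewrite padd; congr (_ + _); change (p (t *: x) = t * p x).
  have [t0'|t0'|->] := ltgtP t 0; last by rewrite scale0r mul0r.
    by rewrite -(opprK (t *: x)) -scaleNr pN (sublinearZ _ hp) ?oppr_gt0// mulNr opprK.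
  exact: sublinearZ.
pose lin := GRing.isLinear.Build R X R^o *:%R (p : X -> R^o) plin.
pose f : {linear X -> R^o} := HB.pack (p : X -> R^o) lin.
by exists f.
Qed.

Lemma hahn_banach q z : sublinear q ->
  exists2 f : {linear X -> R^o}, (forall x, f x <= q x) & f z = q z.
Proof.
move=> hq; have [f fq] := sublinear_minorant (tilt_sublinear z hq).
exists f => [x|]; first exact: le_trans (fq x) (tilt_self z x hq).
apply/eqP; rewrite eq_le (le_trans (fq z) (tilt_self z z hq))/=.
have := fq (- z); rewrite linearN/=.
by have := tilt_le z (- z) hq ler01; rewrite scale1r addNr sublinear0//; lra.
Qed.

End HahnBanach.

Section Dual.
Variables (R : realType) (X : normedModType R).
Implicit Types (f : dual X) (x : X) (C : set X).

Lemma dual_bounded f : exists2 M, 0 < M & forall x, `|f x| <= M * `|x|.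
Proof.
have /linear_bounded_continuous/linear_boundedP/pinfty_ex_gt0[M M0 hM] :=
  @dual_continuous R X f.
by exists M.
Qed.

Lemma mk_dual (f : {linear X -> R^o}) M : (forall x, `|f x| <= M * `|x|) ->
  exists g : dual X, forall x, g x = f x.
Proof.
move=> hM; suff cf : continuous f by exists (Dual cf).
apply/linear_bounded_continuous/bounded_funP => r.
exists (`|M| * r) => x xr; apply: le_trans (hM x) _.
by apply: le_trans (ler_wpM2r _ (ler_norm M)) _ => //; rewrite ler_wpM2l.
Qed.

Lemma dual_normP f x : `|f x| <= dual_norm f * `|x|.
Proof.
have [M M0 hM] := dual_bounded f.
have ub : has_ubound [set `|dual_pairing f x| | x in [set x : X | `|x| <= 1]].
  exists M => _ [y /= y1 <-]; apply: le_trans (hM y) _.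
  by rewrite ger_pMr.
have [->|x0] := eqVneq x 0; first by rewrite linear0 !normr0 mulr0.
have nx : 0 < `|x| by rewrite normr_gt0.
rewrite -ler_pdivrMr//; apply: ub_le_sup => //=; exists (`|x|^-1 *: x) => /=.
  by rewrite normrZ normfV normr_id mulVf ?gt_eqF.
by rewrite /dual_pairing linearZ/= /GRing.scale/= normrM normfV normr_id mulrC.
Qed.

Lemma norming x : exists2 f : dual X, (forall y, `|f y| <= `|y|) & f x = `|x|.
Proof.
have hq : @sublinear R X (fun y => `|y|).
  by split=> [y z|t y t0]; [exact: ler_normD|rewrite normrZ gtr0_norm].
have [f fle fx] := hahn_banach x hq.
have fn y : `|f y| <= 1 * `|y|.
  rewrite mul1r ler_norml fle andbT lerNl -[X in X <= _]linearN/=.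
  by apply: le_trans (fle _) _; rewrite normrN.
by have [g gf] := mk_dual fn; exists g => [y|]; rewrite gf// -[leRHS]mul1r.
Qed.

Definition is_convex C :=
  forall x y t, C x -> C y -> 0 <= t <= 1 -> C (t *: x + (1 - t) *: y).

Lemma convex_setP C : convex_set C <-> is_convex C.
Proof.
split=> [h x y t Cx Cy /andP[t0 t1]|h x y t].
  by have := h x y (Itv01 t0 t1); rewrite !inE; apply.
by rewrite !inE => Cx Cy; apply: h => //; rewrite ge0 le1.
Qed.

(** [q] is the distance to [- K]; it vanishes there, so a linear functional below it is nonnegative
    on [K] and bounded by the norm. *)
Lemma dist_cone_sublinear (K : set X) : K 0 ->
  (forall x y, K x -> K y -> K (x + y)) -> (forall t x, 0 < t -> K x -> K (t *: x)) ->
  let q z := inf [set `|z + k| | k in K] in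
  [/\ sublinear q, forall z k, K k -> q z <= `|z + k| & forall z, 0 <= q z].
Proof.
move=> K0 KD KZ q.
have q_le z k : K k -> q z <= `|z + k|.
  by move=> Kk; apply: ge_inf; [exists 0 => _ [? _ <-]|exists k].
have q_adh z e : 0 < e -> exists2 k, K k & `|z + k| < q z + e.
  move=> e0; have [|_ [k Kk <-]] := @inf_adherent _ [set `|z + k| | k in K] _ e0; last by exists k.
  by split; [exists `|z + 0|; exists 0|exists 0 => _ [? _ <-]].
split=> //; last first.
  by move=> z; apply: lb_le_inf => [|_ [? _ <-]//]; exists `|z + 0|; exists 0.
split=> [x y|t x t0].
  apply/ler_addgt0Pl => e e0; have e2 : 0 < e / 2 by lra.
  have [k Kk hk] := q_adh x _ e2; have [l Kl hl] := q_adh y _ e2.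
  have := q_le (x + y) _ (KD _ _ Kk Kl); have := ler_normD (x + k) (y + l).
  by rewrite addrACA; lra.
apply/ler_addgt0Pl => e e0; have e2 : 0 < e / t by rewrite divr_gt0.
have [k Kk hk] := q_adh x _ e2.
have := q_le (t *: x) _ (KZ _ _ t0 Kk); rewrite -scalerDr normrZ gtr0_norm//.
move/le_trans; apply.
have -> : e + t * q x = t * (q x + e / t) by field; rewrite gt_eqF.
by rewrite ler_pM2l// ltW.
Qed.

(* Hahn-Banach for the distance to the cone spanned by [D - x], where [D] is a
   neighbourhood of [C] in norm. *)
Lemma separation C x : is_convex C -> closed C -> ~ C x ->
  exists (p : dual X) (e : R), 0 < e /\ forall v, C v -> p x + e <= p v.
Proof.
move=> Cc Ccl nCx.
have [[v0 Cv0]|C0] := pselect (C !=set0); last first.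
  have [p _ _] := norming 0; exists p, 1; split=> // v Cv.
  by exfalso; apply: C0; exists v.
have [d d0 dC] : exists2 d, 0 < d & forall v, C v -> d <= `|v - x|.
  have : nbhs x (~` C) by apply: open_nbhs_nbhs; split=> //; exact: closed_openC.
  move=> /nbhs_normP[d /= d0 hd]; exists d => // v Cv; rewrite leNgt; apply/negP => lt.
  by apply: (hd v) => //=; rewrite distrC.
have d2 : 0 < d / 2 by lra.
pose D := [set w | exists2 v, C v & `|w - v| <= d / 2].
have DC : is_convex D.
  move=> w w' t [v Cv hv] [v' Cv' hv'] /andP[t0 t1].
  exists (t *: v + (1 - t) *: v'); first by apply: Cc => //; rewrite t0.
  rewrite opprD addrACA -!scalerBr; apply: le_trans (ler_normD _ _) _.
  rewrite !normrZ !ger0_norm ?subr_ge0//.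
  have := ler_wpM2l t0 hv; have := ler_wpM2l (_ : 0 <= 1 - t) hv'.
  by rewrite subr_ge0 => /(_ t1); lra.
have Dx w : D w -> d / 2 <= `|w - x|.
  move=> [v Cv hv]; have := dC _ Cv; have := ler_distD w v x.
  by rewrite [`|v - w|]distrC; lra.
have CD v : C v -> D v by move=> Cv; exists v => //; rewrite subrr normr0 ltW.
pose K := [set k | exists t w, [/\ 0 <= t, D w & k = t *: (w - x)]].
have KD k l : K k -> K l -> K (k + l).
  move=> [t [w [t0 Dw ->]]] [t' [w' [t0' Dw' ->]]].
  have := addr_ge0 t0 t0'; rewrite le_eqVlt => /predU1P[T0|T0].
    have tt : t = 0 by lra.
    have tt' : t' = 0 by lra.
    by exists 0, w; rewrite tt tt' !scale0r addr0.
  exists (t + t'), (t / (t + t') *: w + (1 - t / (t + t')) *: w'); split; first exact: ltW.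
    apply: DC => //; rewrite divr_ge0 ?(ltW T0)//= ler_pdivrMr//; lra.
  have e1 : (t + t') * (t / (t + t')) = t by field; rewrite gt_eqF.
  have e2 : (t + t') * (1 - t / (t + t')) = t' by field; rewrite gt_eqF.
  by rewrite [RHS]scalerBr [in RHS]scalerDr !scalerA e1 e2 scalerDl opprD addrACA -!scalerBr.
have K0 : K 0 by exists 0, v0; rewrite scale0r; split=> //; exact: CD.
have KZ t k : 0 < t -> K k -> K (t *: k).
  move=> t0 [s [w [s0 Dw ->]]]; exists (t * s), w; rewrite scalerA.
  by split=> //; rewrite mulr_ge0// ltW.
have [qs q_le q0] := dist_cone_sublinear K0 KD KZ.
set q := (fun z => inf _) in qs q_le q0.
have [f fq fz] := hahn_banach (v0 - x) qs.
have fn y : `|f y| <= 1 * `|y|.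
  have fq0 z : f z <= `|z| by have := q_le z 0 K0; rewrite addr0; exact: le_trans.
  rewrite mul1r ler_norml fq0 andbT lerNl -[X in X <= _]linearN/=.
  by rewrite -[leRHS]normrN; exact: fq0.
have fK k : K k -> 0 <= f k.
  move=> Kk; have := q_le (- k) _ Kk; rewrite addNr normr0 => h.
  by have := le_trans (fq (- k)) h; rewrite linearN/= oppr_le0.
have Kv0 : K (v0 - x) by exists 1, v0; rewrite scale1r; split => //; exact: CD.
(* Adding an element of the cone to [v0 - x] gives [1 + t] times a point of [D - x], by convexity of
   [D], and such a point has norm at least [d / 2]. *)
have z0pos : d / 2 <= f (v0 - x).
  rewrite fz; apply: lb_le_inf; first by exists `|v0 - x + 0|; exists 0.
  move=> _ [_ [t [w [t0 Dw ->]]] <-].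
  have T0 : 0 < 1 + t by lra.
  have -> : v0 - x + t *: (w - x) =
      (1 + t) *: ((1 / (1 + t)) *: v0 + (1 - 1 / (1 + t)) *: w - x).
    have e1 : (1 + t) * (1 / (1 + t)) = 1 by field; rewrite gt_eqF.
    have e2 : (1 + t) * (1 - 1 / (1 + t)) = t by field; rewrite gt_eqF.
    by rewrite [RHS]scalerBr [in RHS]scalerDr !scalerA e1 e2 scalerDl !scale1r opprD addrACA -scalerBr.
  rewrite normrZ gtr0_norm//.
  have /Dx h : D ((1 / (1 + t)) *: v0 + (1 - 1 / (1 + t)) *: w).
    apply: DC => //; first exact: CD.
    by rewrite divr_ge0 ?(ltW T0)//= ler_pdivrMr//; lra.
  apply: le_trans h _; rewrite -[leLHS]mul1r ler_wpM2r//; lra.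
have nz0 : 0 < `|v0 - x| by have := dC _ Cv0; lra.
(* A shift by [s *: (v0 - x)] has norm [d / 2], so it moves [C] inside [D]; positivity on the cone
   then turns the shift into the margin [s * f (v0 - x)]. *)
pose s := d / 2 / `|v0 - x|; have s0 : 0 < s by rewrite divr_gt0.
have [p pf] := mk_dual fn.
exists p, (s * f (v0 - x)); split; first by rewrite mulr_gt0//; lra.
move=> v Cv; rewrite !pf.
have : 0 <= f (v - s *: (v0 - x) - x).
  apply: fK; exists 1, (v - s *: (v0 - x)); rewrite scale1r; split=> //.
  exists v => //; rewrite addrAC subrr add0r normrN normrZ gtr0_norm//.
  by rewrite /s divfK// gt_eqF.
rewrite linearB/= linearB/= linearZ/=.
change (s *: f (v0 - x)) with (s * f (v0 - x)).
by lra.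
Qed.

End Dual.

(** * The weak topology *)

Section WeakTopology.
Variables (R : realType) (X : normedModType R).
Implicit Types (f : dual X) (x : X) (A B C : set X) (u : nat -> X).

Lemma weak_continuous f : continuous (dual_pairing f : weak_space X -> R).
Proof.
move=> x C /(@initial_continuous X R (dual_pairing f) x) fxC.
exact: (cvg_sup _ _ (nbhs_filter (x : weak_space X))).1 (@cvg_id _ _) f _ fxC.
Qed.

Lemma weak_nbhs f x e : 0 < e -> nbhs (x : weak_space X) [set y : X | `|f y - f x| < e].
Proof.
move=> e0; have := @weak_continuous f x; move/cvgrPdist_lt => /(_ _ e0).
by apply: filterS => y /=; rewrite distrC.
Qed.

Lemma dual_sep x y : (forall f, f x = f y) -> x = y.
Proof.
move=> h; apply/eqP; rewrite -subr_eq0 -normr_eq0.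
by have [f _ <-] := norming (x - y); rewrite linearB/= h subrr.
Qed.

Lemma norm_nbhs x e : 0 < e -> nbhs x [set y : X | `|y - x| < e].
Proof. by move=> e0; apply: (@cvgr_distC_lt _ _ _ (nbhs x) _ id x) => //; exact: cvg_id. Qed.

Lemma eq_small (a b : R) : (forall e, 0 < e -> `|a - b| <= e) -> a = b.
Proof.
move=> h; apply/eqP; rewrite -subr_eq0 -normr_le0; apply/ler_addgt0Pl => e e0.
by rewrite addr0; exact: h.
Qed.

Lemma weak_cvg_subseq u x (s : nat -> nat) : {homo s : m n / (m < n)%N} ->
  weak_cvg u x -> weak_cvg (u \o s) x.
Proof. by move=> hs; exact: cvg_subseq. Qed.

Lemma norm_weak_cvg u x : u @ \oo --> x -> weak_cvg u x.
Proof.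
move=> ux; apply/weak_cvgP => f.
by apply: cvg_comp ux _; exact: dual_continuous.
Qed.

Lemma weak_cluster A u : weakly_compact A -> (forall k, A (u k)) ->
  exists2 z, A z & forall W, nbhs (z : weak_space X) W ->
    forall N, exists2 k, (N <= k)%N & W (u k).
Proof.
move=> cA Au; have [|z [Az hz]] := cA ((u : nat -> weak_space X) @ \oo) _.
  by exists 0%N => // k _; exact: Au.
exists z => // W zW N.
have uN : ((u : nat -> weak_space X) @ \oo) (u @` [set k | (N <= k)%N]).
  by exists N => // k /= Nk; exists k.
by have [_ [[k /= Nk <-] Wk]] := hz _ _ uN zW; exists k.
Qed.

Lemma weakly_compact_closed A : weakly_compact A -> closed A.
Proof.
move=> cA x xA.
have /choice[u hu] : forall n, exists y, A y /\ `|y - x| <= 1 / n.+1%:R.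
  move=> n; have n0 : 0 < 1 / n.+1%:R :> R by rewrite divr_gt0.
  by have [y [Ay /= yx]] := xA _ (norm_nbhs x n0); exists y; rewrite ltW.
have ux : u @ \oo --> x by apply: (@cvgn0 _ _ _ _ 1) => k; case: (hu k).
have [z Az hz] := weak_cluster cA (fun k => (hu k).1).
suff -> : x = z by [].
apply: dual_sep => f; apply: eq_small => e e0; have e2 : 0 < e / 2 by lra.
have /weak_cvgP/(_ f)/cvgrPdist_lt/(_ _ e2)[N _ hN] := norm_weak_cvg ux.
have [k Nk /= hk] := hz _ (weak_nbhs f z e2) N.
have := hN k Nk; rewrite /= /dual_pairing => hk2.
by have := ler_distD (f (u k)) (f x) (f z); lra.
Qed.

(* Gliding hump: [sum_k +-3^-k h_k], with [h_k] norming [x_k] and the signs chosen so that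
   nothing cancels at [x_n], is unbounded along [x_n] as soon as [|x_n| >= 2 n 3^n]. *)
Lemma weakly_bounded_bounded A :
  (forall f, exists c, forall x, A x -> `|f x| <= c) ->
  exists M, forall x, A x -> `|x| <= M.
Proof.
move=> wb; apply: contrapT => nb.
have /choice[x hx] : forall n, exists x, A x /\ n%:R * 2 * 3 ^+ n < `|x|.
  move=> n; apply: contrapT => nx; apply: nb; exists (n%:R * 2 * 3 ^+ n) => x Ax.
  by rewrite leNgt; apply/negP => lt; apply: nx; exists x.
have /choice[h hh] : forall n, exists h : dual X, (forall y, `|h y| <= `|y|) /\ h (x n) = `|x n|.
  by move=> n; have [h h1 h2] := norming (x n); exists h.
pose r n : R := (3 ^+ n)^-1.
have r0 n : 0 < r n by rewrite invr_gt0 exprn_gt0.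
have rS n : r n = 3 * r n.+1.
  by rewrite /r exprS invfM mulrA divff ?mul1r// pnatr_eq0.
pose e (a : R) : R := if 0 <= a then 1 else -1.
have ne a : `|e a| = 1 by rewrite /e; case: ifP; rewrite ?normrN normr1.
pose fix S (n : nat) (y : X) {struct n} : R := if n is m.+1 then S m y + e (S m (x m)) * r m * h m y else 0.
have Sstep n y : `|S n.+1 y - S n y| <= r n * `|y|.
  rewrite /= addrAC subrr add0r !normrM ne mul1r gtr0_norm//.
  by rewrite ler_wpM2l ?(ltW (r0 n))//; case: (hh n).
(* The tail of the series from [n] on is at most [3 / 2 * 3^-n] times the norm, so [hi] and [lo] are
   monotone brackets of its sum. *)
pose hi n y := S n y + 3 / 2 * r n * `|y|.
pose lo n y := S n y - 3 / 2 * r n * `|y|.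
have hiS y n : hi n.+1 y <= hi n y.
  by have := Sstep n y; rewrite ler_norml /hi rS => /andP[_]; have := normr_ge0 y; nra.
have loS y n : lo n y <= lo n.+1 y.
  by have := Sstep n y; rewrite ler_norml /lo rS => /andP[+ _]; have := normr_ge0 y; nra.
have lohi n y : lo n y <= hi n y.
  by rewrite /lo /hi; have := mulr_ge0 (ltW (r0 n)) (normr_ge0 y); lra.
have himono y : nonincreasing_seq (hi ^~ y) by apply/nonincreasing_seqP => n; exact: hiS.
have lomono y : nondecreasing_seq (lo ^~ y) by apply/nondecreasing_seqP => n; exact: loS.
have hilb y n : lo 0%N y <= hi n y.
  by apply: le_trans (lohi n y); apply: (lomono y).
have hic y : cvgn (hi ^~ y).
  by apply: nonincreasing_is_cvgn => //; exists (lo 0%N y) => _ [n _ <-]; exact: hilb.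
have r_cvg : r n @[n --> \oo] --> (0 : R).
  rewrite /r; under eq_fun do rewrite -exprVn.
  by apply: cvg_expr; rewrite ger0_norm ?invr_ge0//; lra.
pose F y := limn (hi ^~ y).
have SF y : S n y @[n --> \oo] --> F y.
  have -> : (fun n => S n y) = (fun n => hi n y - 3 / 2 * `|y| * r n).
    by apply/funext => n; rewrite /hi; ring.
  by rewrite -[F y]subr0 -[X in _ - X](mulr0 (3 / 2 * `|y|));
    apply: cvgB (hic y) _; apply: cvgMl_tmp.
have Flin : linear (F : X -> R^o).
  move=> a y z; have Slin n : S n (a *: y + z) = a * S n y + S n z.
    by elim: n => [|n /= ->]; rewrite ?mulr0 ?addr0// linearP/= /GRing.scale/=; ring.
  have SFl : S n (a *: y + z) @[n --> \oo] --> a * F y + F z.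
    rewrite (funext Slin); apply: cvgD (SF z).
    by apply: cvgMl_tmp; exact: SF.
  exact: norm_cvg_unique (SF _) SFl.
have Fhi n y : F y <= hi n y.
  by apply: (cvgr_to_le (hic y)); near=> m; apply: (himono y); near: m; exact: nbhs_infty_ge.
have Flo n y : lo n y <= F y.
  apply: (cvgr_to_ge (hic y)); near=> m; apply: le_trans (lohi m y).
  by apply: (lomono y); near: m; exact: nbhs_infty_ge.
pose lin := GRing.isLinear.Build R X R^o *:%R (F : X -> R^o) Flin.
pose Fl : {linear X -> R^o} := HB.pack (F : X -> R^o) lin.
have Fb y : `|Fl y| <= 3 / 2 * `|y|.
  have := Fhi 0%N y; have := Flo 0%N y; rewrite /hi /lo /r /= expr0 invr1 => h1 h2.
  by rewrite ler_norml; apply/andP; split; rewrite /=; lra.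
have [g gF] := mk_dual Fb; have [c hc] := wb g.
have [n nc] : exists n, c < n%:R.
  exists (Num.bound `|c|); exact: le_lt_trans (ler_norm c) (archi_boundP (normr_ge0 c)).
have [Ax xn] := hx n; have := hc _ Ax; rewrite gF.
have xr : n%:R < r n * `|x n| / 2.
  by rewrite ltr_pdivlMr// /r [ltRHS]mulrC ltr_pdivlMr// exprn_gt0.
have rN : 0 <= r n * `|x n| by rewrite mulr_ge0// ltW.
(* The sign makes the [n]-th term add up with the earlier ones, and the later terms total at most
   half of it; this leaves [r n * |x n| / 2], which exceeds [n]. *)
have key : r n * `|x n| <= `|S n.+1 (x n)|.
  rewrite /= (hh n).2 /e -mulrA; case: ifPn => [S0|].
    by rewrite mul1r ger0_norm ?lerDr// addr_ge0.
  by rewrite -ltNge mulN1r => S0; rewrite ler0_norm; lra.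
have d : `|F (x n) - S n.+1 (x n)| <= r n * `|x n| / 2.
  have := Fhi n.+1 (x n); have := Flo n.+1 (x n); rewrite /hi /lo => h1 h2.
  have -> : r n * `|x n| / 2 = 3 / 2 * r n.+1 * `|x n| by rewrite rS; field.
  by rewrite ler_norml; apply/andP; split; lra.
change (Fl (x n)) with (F (x n)).
by have := lerB_dist (S n.+1 (x n)) (F (x n)); rewrite distrC; lra.
Unshelve. all: by end_near. Qed.

End WeakTopology.

(** [d] enumerates the terms built from [a0] with the operations [op j], coded as trees; a malformed
    code evaluates to something harmless that still satisfies [P]. *)
Lemma countable_closure (T : Type) (J : countType) (op : J -> T -> T -> T) (a0 : T)
    (P : T -> Prop) :
  P a0 -> (forall j x y, P x -> P y -> P (op j x y)) ->
  exists2 d : nat -> T, (forall n, P (d n)) &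
    forall j m n, exists k, d k = op j (d m) (d n).
Proof.
move=> P0 Pop.
pose op' k := if unpickle k is Some j then op j else fun x _ => x.
pose fix eval (t : GenTree.tree nat) : T :=
  match t with GenTree.Node k [:: t1; t2] => op' k (eval t1) (eval t2) | _ => a0 end.
have Peval : forall t, P (eval t).
  fix IH 1 => -[//|k [//|t1 [//|t2 [|//]]]] /=.
  rewrite /op'; case: unpickle => [j|]; last exact: IH.
  by apply: Pop; exact: IH.
pose tr n := odflt (GenTree.Leaf 0%N) (unpickle n : option (GenTree.tree nat)).
exists (fun n => eval (tr n)) => [n|j m n]; first exact: Peval.
exists (pickle (GenTree.Node (pickle j) [:: tr m; tr n])).
by rewrite {1}/tr pickleK /= /op' pickleK.
Qed.

(** * Weak sequential compactness *)

Section Separable.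
Variables (R : realType) (X : normedModType R).
Implicit Types (f : dual X) (x : X) (A B C : set X) (u : nat -> X).

Lemma weakly_compact_bounded A : weakly_compact A ->
  exists M, forall x, A x -> `|x| <= M.
Proof.
move=> cA; apply: weakly_bounded_bounded => f; apply: contrapT => nb.
have /choice[u hu] : forall n : nat, exists x, A x /\ n%:R < `|f x|.
  move=> n; apply: contrapT => nx; apply: nb; exists n%:R => x Ax.
  by rewrite leNgt; apply/negP => lt; apply: nx; exists x.
have [z Az hz] := weak_cluster cA (fun k => (hu k).1).
have [k kN /= hk] := hz _ (weak_nbhs f z ltr01) (Num.bound (`|f z| + 1)).
have : `|f z| + 1 < `|f (u k)|.
  apply: le_lt_trans (hu k).2; apply: le_trans (ltW (archi_boundP _)) _; first by rewrite addr_ge0.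
  by rewrite ler_nat.
by have := lerB_dist (f (u k)) (f z); lra.
Qed.

Definition adh (d : nat -> X) := [set x : X | forall e, 0 < e -> exists n, `|d n - x| <= e].

Lemma adh_range d n : adh d (d n).
Proof. by move=> e e0; exists n; rewrite subrr normr0 ltW. Qed.

Lemma adh_closed d : closed (adh d).
Proof.
move=> x hx e e0; have e2 : 0 < e / 2 by lra.
have [y [/(_ _ e2)[n dn] /= yx]] := hx _ (norm_nbhs x e2).
by exists n; have := ler_distD y (d n) x; lra.
Qed.

Lemma adh_sub d A : closed A -> (forall n, A (d n)) -> adh d `<=` A.
Proof.
move=> cA Ad x hx; apply: cA => W /nbhs_normP[e /= e0 he].
have [n dn] := hx (e / 2) ltac:(by rewrite divr_gt0).
exists (d n); split=> //; apply: he => /=; rewrite distrC.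
by apply: le_lt_trans dn _; lra.
Qed.

Lemma adh_is_convex d :
  (forall (t : rat) m n, 0 <= (ratr t : R) <= 1 ->
     exists k, d k = ratr t *: d m + (1 - ratr t) *: d n) ->
  is_convex (adh d).
Proof.
move=> hd x y t dx dy /andP[]; rewrite !le_eqVlt => /predU1P[<-|t0].
  by rewrite scale0r add0r subr0 scale1r.
move=> /predU1P[->|t1]; first by rewrite subrr scale0r addr0 scale1r.
move=> e e0; have e3 : 0 < e / 3 by lra.
have [m hm] := dx _ e3; have [n hn] := dy _ e3.
(* Moving the parameter by [c] moves the point by at most [e / 3]; the [+ 1] covers [x = y]. *)
pose c := e / 3 / (`|x - y| + 1).
have c0 : 0 < c by rewrite !divr_gt0// ltr_wpDl.
have [s] : exists s : rat, ratr s \in `]Num.max 0 (t - c), t[%R.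
  by apply: rat_in_itvoo; rewrite gt_max t0 /= ltrBlDr ltrDl.
rewrite in_itv/= gt_max => /andP[/andP[s0 sc] st].
have s01 : 0 <= (ratr s : R) <= 1 by rewrite (ltW s0)/= ltW// (lt_trans st).
have [k dk] := hd s m n s01; exists k; rewrite dk.
move: (ratr s : R) s0 sc st s01 {dk} => a s0 sc st s01.
have line (b : R) : b *: x + (1 - b) *: y = y + b *: (x - y).
  by rewrite scalerBl scale1r scalerBr addrCA.
have h1 : `|a *: d m + (1 - a) *: d n - (a *: x + (1 - a) *: y)| <= e / 3 + e / 3.
  rewrite opprD addrACA -!scalerBr; apply: le_trans (ler_normD _ _) _.
  have a1 : 0 <= 1 - a by lra.
  rewrite !normrZ (ger0_norm (ltW s0)) (ger0_norm a1).
  by have := normr_ge0 (d m - x); have := normr_ge0 (d n - y); nra.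
have h2 : `|a *: x + (1 - a) *: y - (t *: x + (1 - t) *: y)| <= e / 3.
  rewrite !line opprD addrACA subrr add0r -scalerBl normrZ.
  have -> : e / 3 = c * (`|x - y| + 1) by rewrite /c divfK// gt_eqF// ltr_wpDl.
  apply: ler_pM => //; last by rewrite lerDl.
  by rewrite distrC ger0_norm; lra.
have := ler_distD (a *: x + (1 - a) *: y) (a *: d m + (1 - a) *: d n) (t *: x + (1 - t) *: y).
by lra.
Qed.

(** Mazur's argument: a functional separating [z] from [C] keeps the whole sequence out of a weak
    neighbourhood of [z]. *)
Lemma cluster_convex C u z : is_convex C -> closed C -> (forall k, C (u k)) ->
  (forall W, nbhs (z : weak_space X) W -> exists k, W (u k)) -> C z.
Proof.
move=> Cc Ccl Cu hz; apply: contrapT => nCz.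
have [p [e [e0 hp]]] := separation Cc Ccl nCz.
have [k /=] := hz _ (weak_nbhs p z e0).
by have := hp _ (Cu k); rewrite ltr_norml => h1 /andP[_]; lra.
Qed.

(** The functionals norm all differences [d i - d j]. If they agreed at [x] and [z], approximation
    within an eighth of the distance would bound [|d i - d j|] by a quarter of it and [|x - z|] by
    half of itself. *)
Lemma separating_sequence d : exists q : nat -> dual X,
  forall x z, adh d x -> adh d z -> (forall k, q k x = q k z) -> x = z.
Proof.
pose ij k := odflt (0, 0)%N (unpickle k).
have /choice[q hq] : forall k, exists f : dual X, (forall y, `|f y| <= `|y|) /\
    f (d (ij k).1 - d (ij k).2) = `|d (ij k).1 - d (ij k).2|.
  by move=> k; have [f h1 h2] := norming (d (ij k).1 - d (ij k).2); exists f.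
exists q => x z dx dz qxz; apply/eqP; rewrite -subr_eq0 -normr_le0 leNgt; apply/negP => e0.
have e8 : 0 < `|x - z| / 8 by lra.
have [i hi] := dx _ e8; have [j hj] := dz _ e8.
have [q1 q2] := hq (pickle (i, j)); have := qxz (pickle (i, j)).
move: q1 q2; rewrite /ij pickleK /=; move: (q _) => f f1 f2 fxz.
have := f1 (d i - x); have := f1 (d j - z).
rewrite !linearB/= fxz in f2 *; rewrite !ler_norml => /andP[? ?] /andP[? ?].
have := ler_distD (d i) x z; have := ler_distD (d j) (d i) z.
by rewrite [`|x - d i|]distrC; lra.
Qed.

(* A weak cluster point of a subsequence agrees with [x] on all [q k], hence equals [x]. *)
Lemma adh_weak_cvg A d (q : nat -> dual X) u x : weakly_compact A -> adh d `<=` A ->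
  is_convex (adh d) ->
  (forall x z, adh d x -> adh d z -> (forall k, q k x = q k z) -> x = z) ->
  (forall n, adh d (u n)) -> adh d x ->
  (forall k, q k (u n) @[n --> \oo] --> q k x) -> weak_cvg u x.
Proof.
move=> cA dA dc qsep du dx qu; apply/weak_cvgP => f; apply/cvgrPdist_lt => e e0.
apply: contrapT => nf.
have [j N|s hs fs] := @extraction (fun j k => e <= `|f (u k) - f x|).
  apply: contrapT => nk; apply: nf; exists N => // k /= Nk.
  rewrite ltNge; apply/negP => le; apply: nk; exists k => //.
  by rewrite distrC.
have [z Az hz] := weak_cluster cA (fun k => dA _ (du (s k))).
have dz : adh d z.
  apply: (cluster_convex dc (@adh_closed d) (fun k => du (s k))) => W zW.
  by have [k _ Wk] := hz _ zW 0%N; exists k.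
have xz : x = z.
  apply: qsep => // k; apply: eq_small => a a0; have a2 : 0 < a / 2 by lra.
  have /cvgrPdist_lt/(_ _ a2)[N _ hN] := cvg_subseq hs (qu k).
  have [m Nm /= hm] := hz _ (weak_nbhs (q k) z a2) N.
  by have := hN m Nm; rewrite /=; have := ler_distD (q k (u (s m))) (q k x) (q k z); lra.
have [k _ /=] := hz _ (weak_nbhs f z e0) 0%N.
by rewrite -xz ltNge fs.
Qed.

(** The [j]-th index is chosen so that the first [j.+1] separating functionals are within [1 / j.+1]
    of their values at a cluster point. *)
Lemma adh_weak_subseq A d u : weakly_compact A -> adh d `<=` A ->
  is_convex (adh d) -> (forall n, adh d (u n)) ->
  exists2 s : nat -> nat, {homo s : m n / (m < n)%N} &
    exists2 x, adh d x & weak_cvg (u \o s) x.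
Proof.
move=> cA dA dc du; have [q qsep] := separating_sequence d.
have [x Ax hx] := weak_cluster cA (fun k => dA _ (du k)).
have dx : adh d x.
  apply: (cluster_convex dc (@adh_closed d) du) => W xW.
  by have [k _ Wk] := hx _ xW 0%N; exists k.
have [j N|s hs qs] := @extraction
    (fun j k => forall i : 'I_j.+1, `|q i (u k) - q i x| < 1 / j.+1%:R).
  have j0 : 0 < 1 / j.+1%:R :> R by rewrite divr_gt0.
  apply: (hx [set y | forall i : 'I_j.+1, `|q i y - q i x| < 1 / j.+1%:R]).
  apply: (@filter_forall _ _ (fun (i : 'I_j.+1) (y : weak_space X) =>
    `|q i y - q i x| < 1 / j.+1%:R) (nbhs (x : weak_space X))) => i.
  exact: weak_nbhs.
exists s => //; exists x => //.
apply: (adh_weak_cvg cA dA dc qsep (fun n => du (s n)) dx) => k.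
apply/cvgrPdist_lt => e e0.
have [N hN] : exists N, 1 / N.+1%:R < e.
  exists (Num.bound e^-1); rewrite div1r invf_plt ?posrE//.
  apply: lt_trans (archi_boundP _) _; first by rewrite invr_ge0 ltW.
  by rewrite ltr_nat.
exists (maxn k N) => // m /=; rewrite geq_max => /andP[km Nm].
have km1 : (k < m.+1)%N by rewrite ltnS.
rewrite distrC; apply: lt_trans (qs m (Ordinal km1)) _; apply: le_lt_trans hN.
by rewrite !div1r lef_pV2 ?posrE// ler_nat.
Qed.

(** The Eberlein-Smulian theorem for convex sets: the terms of [u], as constant operations, and
    rational convex combinations generate a separable closed convex subset of [A] containing the
    sequence. *)
Lemma eberlein A u : weakly_compact A -> is_convex A -> (forall n, A (u n)) ->
  exists2 s : nat -> nat, {homo s : m n / (m < n)%N} &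
    exists2 x, A x & weak_cvg (u \o s) x.
Proof.
move=> cA Ac Au.
pose op (j : rat + nat) (x y : X) := match j with
  | inl t => if (0 <= (ratr t : R) <= 1) then ratr t *: x + (1 - ratr t) *: y else x
  | inr n => u n end.
have [|d Ad dop] := @countable_closure X (rat + nat)%type op (u 0%N) A (Au 0%N).
  by move=> [t|n] x y Ax Ay //=; case: ifP => // t01; exact: Ac.
have dA : adh d `<=` A by apply: adh_sub => //; exact: weakly_compact_closed.
have [||s hs [x dx sx]] := @adh_weak_subseq A d u cA dA.
- apply: adh_is_convex => t m n t01.
  by have [k] := dop (inl t) m n; rewrite /= t01; exists k.
- by move=> n; have [k] := dop (inr n) 0%N 0%N; rewrite /= => <-; exact: adh_range.
by exists s => //; exists x => //; exact: dA.
Qed.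

End Separable.

(** * Pseudomonotone operators and weakly Mosco-continuous maps *)

Section Operator.
Variables (R : realType) (X : normedModType R) (F : X -> dual X) (Phi : X -> set X).
Variable A : set X.
Hypotheses (hFb : bounded_operator F) (hFp : pseudomonotone F)
  (hPhi : weakly_mosco_continuous Phi)
  (hAconv : is_convex A) (hAcomp : weakly_compact A)
  (hPhiA : forall x, A x -> Phi x `<=` A).

(** Pseudomonotonicity with the extended limsup and liminf replaced by eventual inequalities up to
    [e]. *)
Lemma pseudomonotone_near (u : nat -> X) x : weak_cvg u x ->
  (forall e, 0 < e -> \forall k \near \oo, F (u k) (u k - x) <= e) ->
  forall y e, 0 < e -> \forall k \near \oo, F x (x - y) <= F (u k) (u k - y) + e.
Proof.
move=> ux hu y e e0.
have /(_ y) : forall y, ((dual_pairing (F x) (x - y))%:E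
       <= limn_einf (fun k => (dual_pairing (F (u k)) (u k - y))%:E))%E.
  apply: hFp => //; apply/lee_addgt0Pr => a a0; rewrite add0e.
  have [N _ hN] := hu _ a0.
  apply: le_trans (ereal_inf_lbound _) _.
    by exists [set k | (N <= k)%N] => //; exists N.
  by apply: ge_ereal_sup => _ [k /= Nk <-]; rewrite lee_fin; exact: hN.
rewrite /limn_einf /limn_esup /limf_esup leeNr => h.
have /ereal_inf_lt[_ [V VN <-] hV] :
    (ereal_inf [set ereal_sup ((\- (fun k => (dual_pairing (F (u k)) (u k - y))%:E))%E @` V)
      | V in (\oo : set_system nat)] < (- F x (x - y) + e)%:E)%E.
  by apply: le_lt_trans h _; rewrite -EFinN lte_fin ltrDl.
apply: filterS VN => k Vk.
have : ((- F (u k) (u k - y))%:E < (- F x (x - y) + e)%:E)%E.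
  by apply: le_lt_trans hV; apply: ereal_sup_ubound; exists k.
by rewrite lte_fin; lra.
Qed.

Lemma operator_bounded :
  exists2 C, 0 < C & forall x y, A x -> `|F x y| <= C * `|y|.
Proof.
have [M hM] := weakly_compact_bounded hAcomp.
have [|C hC] := hFb (B := A).
  by exists M; split; [exact: num_real|move=> r Mr x /hM /le_trans; apply; exact: ltW].
exists (`|C| + 1) => [|x y Ax]; first by rewrite ltr_wpDl.
apply: le_trans (dual_normP _ _) _; rewrite ler_wpM2r//.
have : dual_norm (F x) <= C by apply: hC; exists x.
by have := ler_norm C; lra.
Qed.

(** Boundedness makes [F (u k) (u k - x)] vanish; pseudomonotonicity tested at [x - y] and [x + y]
    then gives the two one-sided bounds. *)
Lemma demicontinuous (u : nat -> X) x : (forall k, A (u k)) -> u @ \oo --> x ->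
  forall y, F (u k) y @[k --> \oo] --> F x y.
Proof.
move=> Au ux y; have [C C0 hC] := operator_bounded.
have small e : 0 < e -> \forall k \near \oo, `|F (u k) (u k - x)| <= e.
  move=> e0; have /cvgrPdist_le/(_ _ (divr_gt0 e0 C0)) := ux; apply: filterS => k hk.
  apply: le_trans (hC _ _ (Au k)) _; rewrite mulrC -ler_pdivlMr// distrC//.
have up e : 0 < e -> \forall k \near \oo, F (u k) (u k - x) <= e.
  by move=> /small; apply: filterS => k; apply: le_trans; exact: ler_norm.
have pm := pseudomonotone_near (norm_weak_cvg ux) up.
apply/cvgrPdist_le => e e0; have e2 : 0 < e / 2 by lra.
near=> k.
have h0 : `|F (u k) (u k - x)| <= e / 2 by near: k; exact: small.
have h1 : F x (x - (x - y)) <= F (u k) (u k - (x - y)) + e / 2 by near: k; exact: pm.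
have h2 : F x (x - (x + y)) <= F (u k) (u k - (x + y)) + e / 2 by near: k; exact: pm.
move: h0 h1 h2; rewrite !linearB/= !linearD/=.
rewrite !ler_norml => /andP[h0 h0'] h1 h2.
by apply/andP; split; lra.
Unshelve. all: by end_near. Qed.

Lemma demicontinuous_diag (u : nat -> X) x y : (forall k, A (u k)) -> u @ \oo --> x ->
  F (u k) (u k - y) @[k --> \oo] --> F x (x - y).
Proof.
move=> Au ux; have [C C0 hC] := operator_bounded.
have Fux : F (u k) (u k - x) @[k --> \oo] --> (0 : R).
  apply/cvgr0Pnorm_le => e e0.
  have /cvgrPdist_le/(_ _ (divr_gt0 e0 C0)) := ux; apply: filterS => k hk.
  by apply: le_trans (hC _ _ (Au k)) _; rewrite mulrC -ler_pdivlMr// distrC.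
have -> : (fun k => F (u k) (u k - y)) = (fun k => F (u k) (u k - x) + F (u k) (x - y)).
  by apply/funext => k; rewrite -linearD/= addrA subrK.
by rewrite -[F x _]add0r; apply: cvgD Fux _; exact: demicontinuous.
Qed.

(** On a sequence of counterexamples converging to [x], the recovery half of Mosco convergence
    provides [v], and demicontinuity preserves the strict inequality. *)
Lemma locally_good x y a b : A x -> Phi x y -> 0 < a -> b < F x (x - y) ->
  exists2 r, 0 < r & forall z, A z -> `|z - x| <= r ->
    (exists2 v, Phi z v & `|y - v| <= a) /\ b < F z (z - y).
Proof.
move=> Ax Pxy a0 bF; apply: contrapT => nr.
have /choice[u hu] : forall n : nat, exists z, [/\ A z, `|z - x| <= 1 / n.+1%:R &
    ~ ((exists2 v, Phi z v & `|y - v| <= a) /\ b < F z (z - y))].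
  move=> n; apply: contrapT => nz; apply: nr; exists (1 / n.+1%:R) => [|z Az zx].
    by rewrite divr_gt0.
  by apply: contrapT => nn; apply: nz; exists z.
have Au k : A (u k) by case: (hu k).
have ux : u @ \oo --> x by apply: (@cvgn0 _ _ _ _ 1) => k; case: (hu k).
have [+ _] := hPhi (norm_weak_cvg ux); move=> /(_ _ Pxy)[v Pv vy].
have Fu := @demicontinuous_diag u x y Au ux.
have [k [hk1 hk2]] : exists k, `|y - v k| <= a /\ b < F (u k) (u k - y).
  have h1 : \forall k \near \oo, `|y - v k| <= a by have /cvgrPdist_le := vy; exact.
  have h2 : \forall k \near \oo, b < F (u k) (u k - y) by exact: (cvgr_gt _ Fu).
  by have [k ? ] := @filter_ex _ _ _ _ (filterI h1 h2); exists k.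
have [_ _ []] := hu k; split=> //; exists (v k) => //; exact: Pv.
Qed.

Section Neighbourhoods.
Variables (u : nat -> X) (x : X).
Hypotheses (Au : forall k, A (u k)) (ux : weak_cvg u x).

(** The offending points [v] have a weakly convergent subsequence in [A]; its limit is in [Phi x] by
    the closedness half of Mosco convergence and violates the margin. *)
Lemma separation_stable (p : dual X) e :
  (forall v, Phi x v -> p x + e <= p v) -> 0 < e ->
  (forall k, exists2 v, Phi (u k) v & p v < p (u k) + e / 2) -> False.
Proof.
move=> pe e0 hu.
have /choice[v hv] : forall k, exists v, Phi (u k) v /\ p v < p (u k) + e / 2.
  by move=> k; have [v] := hu k; exists v.
have [s hs [z Az vz]] := eberlein hAcomp hAconv (fun k => hPhiA (Au k) (hv k).1).
have Pz : Phi x z.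
  by have [_] := hPhi ux; apply; [exact: (fun k => (hv k).1)|exists s].
have := pe _ Pz.
have /weak_cvgP/(_ p) cv := vz.
have /weak_cvgP/(_ p) cu := weak_cvg_subseq hs ux.
suff : p z <= p x + e / 2 by lra.
have cu2 : (p (u (s k)) + e / 2) @[k --> \oo] --> (p x + e / 2 : R).
  by apply: cvgD cu _; exact: cvg_cst.
apply: (ler_cvg_to cv cu2); near=> k.
by apply: ltW; case: (hv (s k)).
Unshelve. all: by end_near. Qed.

(** Recovery sequences give [F (u k) (u k - z) <= e] eventually for each [z] in [Phi x]. The choice
    [z = x] is the premise of pseudomonotonicity, and [z = y] contradicts its conclusion. *)
Lemma improvement_stable y : Phi x x -> Phi x y -> 0 < F x (x - y) ->
  (forall k v, Phi (u k) v -> F (u k) (u k - v) <= 0) -> False.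
Proof.
move=> Pxx Pxy Fxy hu; have [C C0 hC] := operator_bounded.
have [low _] := hPhi ux.
have approx z : Phi x z -> forall e, 0 < e -> \forall k \near \oo, F (u k) (u k - z) <= e.
  move=> /low[v Pv vz] e e0.
  have /cvgrPdist_le/(_ _ (divr_gt0 e0 C0)) := vz; apply: filterS => k hk.
  have -> : u k - z = (u k - v k) + (v k - z) by rewrite addrA subrK.
  rewrite linearD/=; have := hu k _ (Pv k).
  have : F (u k) (v k - z) <= e.
    apply: le_trans (ler_norm _) _; apply: le_trans (hC _ _ (Au k)) _.
    by rewrite mulrC -ler_pdivlMr// distrC.
  by lra.
have e0 : 0 < F x (x - y) / 3 by lra.
have h1 := pseudomonotone_near ux (approx _ Pxx) y e0.
have [k [hk1 hk2]] := @filter_ex _ _ _ _ (filterI h1 (approx _ Pxy _ e0)).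
by lra.
Qed.

End Neighbourhoods.
End Operator.

(** * Finite covers and weights *)

Lemma is_convex_simplex (R : realType) (X : normedModType R) (C : set X) : is_convex C ->
  forall n (l : 'I_n -> R) (a : 'I_n -> X), simplex l -> (forall i, C (a i)) ->
  C (\sum_i l i *: a i).
Proof.
move=> Cc; elim=> [l a [_]|n IH l a [l0 l1] Ca].
  by rewrite big_ord0 => /esym/eqP; rewrite oner_eq0.
rewrite big_ord_recl in l1; rewrite big_ord_recl.
set r := \sum_i _ in l1.
have r0 : 0 <= r by rewrite sumr_ge0.
have [rz|rn] := eqVneq r 0.
  rewrite rz addr0 in l1; rewrite l1 scale1r big1 ?addr0// => i _.
  have /eqP := rz; rewrite psumr_eq0//.
  by move/allP/(_ i); rewrite mem_index_enum => /(_ isT)/= /eqP ->; rewrite scale0r.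
have rp : 0 < r by rewrite lt_neqAle eq_sym rn.
have -> : \sum_(i < n) l (lift ord0 i) *: a (lift ord0 i) =
    (1 - l ord0) *: \sum_(i < n) (l (lift ord0 i) / r) *: a (lift ord0 i).
  rewrite -l1 addrAC subrr add0r scaler_sumr; apply: eq_bigr => i _.
  by rewrite scalerA mulrC divfK.
apply: Cc => //; last by rewrite l0/=; lra.
apply: IH => //; split=> [i|]; first by rewrite divr_ge0.
by rewrite -mulr_suml divff.
Qed.

(** If no finite family covers [B], the uncovered parts generate a proper filter; its cluster point
    lies in [B] by separation and is covered by its own neighbourhood. *)
Lemma finite_cover (R : realType) (X : normedModType R) (A B : set X) (U : X -> set X) :
  weakly_compact A -> B `<=` A -> is_convex B -> closed B ->
  (forall x, B x -> nbhs (x : weak_space X) (U x)) ->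
  exists2 s : seq X, (forall i, i \in s -> B i) &
    forall x, B x -> exists2 i, i \in s & U i x.
Proof.
move=> cA BA Bc Bcl hU; apply: contrapT => ns.
pose G : set_system (weak_space X) := filter_from
  [set s : seq X | forall i, i \in s -> B i]
  (fun s => [set x | B x /\ forall i, i \in s -> ~ U i x]).
have GP : ProperFilter G.
  apply: filter_from_proper; last first.
    move=> s sB; apply: contrapT => ne; apply: ns; exists s => // x Bx.
    apply: contrapT => nx; apply: ne; exists x; split=> // i si Ui.
    by apply: nx; exists i.
  apply: filter_from_filter; first by exists [::].
  move=> s1 s2 h1 h2; exists (s1 ++ s2).
    by move=> i /=; rewrite mem_cat => /orP[/h1|/h2].
  move=> x [Bx hx]; split; split=> // i si; apply: hx; rewrite mem_cat si ?orbT//.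
have [|z [Az hz]] := cA G GP.
  by exists [::] => // x [/BA].
have Bz : B z.
  apply: contrapT => nBz; have [p [e [e0 hp]]] := separation Bc Bcl nBz.
  have GB : G B by exists [::] => // x [].
  have [y [By /=]] := hz _ _ GB (weak_nbhs p z e0).
  by have := hp _ By; rewrite ltr_norml => ? /andP[_]; lra.
have Gz : G [set x | B x /\ forall i, i \in [:: z] -> ~ U i x].
  by exists [:: z] => // i; rewrite inE => /eqP ->.
have [y [[_ hy] Uy]] := hz _ _ Gz (hU _ Bz).
by apply: (hy z); rewrite ?inE.
Qed.

Lemma common_margin (R : realType) (I : eqType) (s : seq I) (Q : I -> R -> Prop) :
  (forall i a b, 0 < a <= b -> Q i b -> Q i a) ->
  (forall i, i \in s -> exists2 a, 0 < a & Q i a) ->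
  exists2 a, 0 < a & forall i, i \in s -> Q i a.
Proof.
move=> Qanti; elim: s => [|i s IH] h; first by exists 1.
have [a a0 ha] := IH (fun j js => h j (mem_behead (s := i :: s) js)).
have [b b0 hb] := h i (mem_head _ _).
have m0 : 0 < Num.min a b by rewrite lt_min a0.
exists (Num.min a b) => // j; rewrite inE => /predU1P[->|js].
  by apply: Qanti hb; rewrite m0 ge_min lexx orbT.
by apply: Qanti (ha _ js); rewrite m0 ge_min lexx.
Qed.

Section Weights.
Variables (R : realType) (X : normedModType R) (q : nat -> dual X).

(** [m] governs both the number of functionals and the radius, so that a choice of one point with
    positive gap for each [m] converges to [x] along every [q k]. *)
Definition gap m x z : R := m.+1%:R^-1 - \sum_(k < m) `|q k z - q k x|.

(** Twice the positive part of [gap]. *)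
Definition weight m x z := gap m x z + `|gap m x z|.

Lemma gap_cvg m x (G : set_system X) z : Filter G ->
  (forall k, (q k w : R) @[w --> G] --> (q k z : R)) -> gap m x w @[w --> G] --> gap m x z.
Proof.
move=> FG qG; apply: cvgB; first exact: cvg_cst.
apply: (@cvg_big R _ +%R 0 xpredT add_continuous _ G _
  (fun (k : 'I_m) w => `|q k w - q k x|) (fun k => `|q k z - q k x|)) => k _.
by apply: cvg_norm; apply: cvgB (qG k) _; exact: cvg_cst.
Qed.

Lemma weight_cvg m x (G : set_system X) z : Filter G ->
  (forall k, (q k w : R) @[w --> G] --> (q k z : R)) ->
  weight m x w @[w --> G] --> weight m x z.
Proof.
move=> FG qG; have h := @gap_cvg m x G z FG qG; by apply: (cvgD h); apply: cvg_norm; exact: h.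
Qed.

Lemma weight_ge0 m x z : 0 <= weight m x z.
Proof. by rewrite /weight; have := ler_norm (- gap m x z); rewrite normrN; lra. Qed.

Lemma weight_le2 m x z : weight m x z <= 2.
Proof.
have m1 : (m.+1%:R : R)^-1 <= 1 by rewrite invf_le1 ?ltr0Sn// ler1n.
have g1 : gap m x z <= 1.
  by apply: le_trans m1; rewrite gerBl sumr_ge0.
rewrite /weight; have [h|h] := lerP 0 (gap m x z); first by rewrite ger0_norm; lra.
by rewrite ltr0_norm; lra.
Qed.

Lemma weight_gt0 m x z : (0 < weight m x z) = (0 < gap m x z).
Proof.
rewrite /weight; have [h|h] := lerP (gap m x z) 0.
  by rewrite ler0_norm// subrr ltxx.
by rewrite gtr0_norm// addr_gt0.
Qed.

Lemma weight_self m x : 0 < weight m x x.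
Proof.
by rewrite weight_gt0 /gap big1 ?subr0 ?invr_gt0// => k _; rewrite subrr normr0.
Qed.

Lemma weight_nbhs m x z : 0 < weight m x z ->
  nbhs (z : weak_space X) [set w : X | 0 < weight m x w].
Proof.
move=> wz; have h := @weight_cvg m x (nbhs (z : weak_space X)) z _
  (fun k => @weak_continuous R X (q k) z).
move: h => /(_ (nbhs_filter (z : weak_space X)))/cvgrPdist_lt/(_ _ wz); apply: filterS => w /=.
by rewrite ltr_norml => /andP[_]; lra.
Qed.

Lemma gap_seq (u : nat -> X) x : (forall m, 0 < gap m x (u m)) ->
  forall k, (q k (u n) : R) @[n --> \oo] --> (q k x : R).
Proof.
move=> hu k; have h n : (k < n)%N -> `|q k (u n) - q k x| < n.+1%:R^-1.
  move=> kn; have := hu n; rewrite /gap (bigD1 (Ordinal kn))//= => h.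
  move: h; rewrite subr_gt0; apply: le_lt_trans.
  by rewrite lerDl sumr_ge0.
apply/cvgrPdist_lt => e e0; near=> n.
rewrite distrC; apply: lt_trans (h n _) _; first by near: n; exact: nbhs_infty_gt.
by near: n; exact: (cvgr_lt _ (@cvg_harmonic R)).
Unshelve. all: by end_near. Qed.

End Weights.

(** * The Galerkin scheme *)

Section Galerkin.
Variables (R : realType) (X : normedModType R) (F : X -> dual X) (A : set X).
Variables (q : nat -> dual X) (d : nat -> X).
Variables (s : seq X) (m : X -> nat) (t : X -> option (dual X)).
Hypotheses (hFb : bounded_operator F) (hFp : pseudomonotone F)
  (hAcomp : weakly_compact A) (dA : adh d `<=` A) (dc : is_convex (adh d)).

Let wt i z := weight q (m i) i z.

(* The test functional of the weighted problem at [z]: a centre [i] contributes its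
   separating functional when [t i = Some p], and [- F z] when [t i = None]. *)
Definition sep_part z y := \sum_(i <- s) wt i z * (if t i is Some p then p y : R else 0).
Definition vi_part z := \sum_(i <- s) wt i z * (if t i is Some _ then 0 else 1 : R).
Definition pot z y : R := sep_part z y - vi_part z * F z y.

Lemma pot_linear z : linear (pot z : X -> R^o).
Proof.
move=> a x y; have sl : sep_part z (a *: x + y) = a * sep_part z x + sep_part z y.
  rewrite /sep_part mulr_sumr -big_split/=; apply: eq_bigr => i _.
  by case: (t i) => [p|]; rewrite ?linearP/= /GRing.scale/=; ring.
by rewrite /pot sl linearP/= /GRing.scale/=; ring.
Qed.

Lemma pot0 z : pot z 0 = 0.
Proof.
rewrite /pot linear0 mulr0 /sep_part big1 ?subr0// => i _.
by case: (t i) => [p|]; rewrite ?linear0 mulr0.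
Qed.

Lemma pot_comb z n (l : 'I_n -> R) (y : 'I_n -> X) :
  \sum_i l i * pot z (y i) = pot z (\sum_i l i *: y i).
Proof.
by elim/big_rec2: _ => [|i a b _ ->]; [rewrite pot0|rewrite pot_linear].
Qed.

Lemma pot_diff z y : pot z (y - z) = sep_part z (y - z) + vi_part z * F z (z - y).
Proof. by rewrite /pot -mulrN -linearN/= opprB. Qed.

Lemma vi_part_ge0 z : 0 <= vi_part z.
Proof. by apply: sumr_ge0 => i _; rewrite mulr_ge0 ?weight_ge0//; case: (t i). Qed.

Lemma part_bounded : exists2 K, 0 < K &
  (forall z, vi_part z <= K) /\ forall z y, `|sep_part z y| <= K * `|y|.
Proof.
have /choice[M hM] : forall i, exists M, 0 <= M /\
    forall y, `|if t i is Some p then p y : R else 0| <= M * `|y|.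
  move=> i; case: (t i) => [p|].
    by have [M M0 hM] := dual_bounded p; exists M; split=> //; exact: ltW.
  by exists 0; split=> // y; rewrite normr0 mul0r.
have K0 : 0 <= \sum_(i <- s) 2 * (M i + 1).
  by apply: sumr_ge0 => i _; have [] := hM i; lra.
exists (\sum_(i <- s) 2 * (M i + 1) + 1); first by lra.
have KE z (h : X -> R) c : 0 <= c -> (forall i, `|h i| <= (M i + 1) * c) ->
    `|\sum_(i <- s) wt i z * h i| <= (\sum_(i <- s) 2 * (M i + 1) + 1) * c.
  move=> c0 hh; apply: le_trans (ler_norm_sum _ _ _) _.
  rewrite mulrDl mul1r mulr_suml -[leLHS]addr0 lerD//.
  apply: ler_sum => i _; rewrite normrM -mulrA ler_pM//.
  by rewrite ger0_norm ?weight_ge0// weight_le2.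
split=> [z|z y].
  apply: le_trans (ler_norm _) _; rewrite -[leRHS]mulr1.
  apply: KE => // i; have [M0 _] := hM i.
  by case: (t i) => [p|]; rewrite ?normr0 ?normr1; lra.
apply: KE => // i; have [M0 hMi] := hM i.
by apply: le_trans (hMi y) _; rewrite ler_wpM2r//; lra.
Qed.

Section Limits.
Variables (u : nat -> X) (x : X).
Hypothesis ux : weak_cvg u x.

Let wt_cvg i : wt i (u n) @[n --> \oo] --> wt i x.
Proof. by apply: (@weight_cvg _ _ q (m i) i (u @ \oo) x) => k; move/weak_cvgP: ux; exact. Qed.

Lemma sep_part_cvg y : sep_part (u n) (y - u n) @[n --> \oo] --> sep_part x (y - x).
Proof.
apply: (@cvg_big R _ +%R 0 xpredT add_continuous _ \oo s
  (fun i n => wt i (u n) * (if t i is Some p then p (y - u n) : R else 0))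
  (fun i => wt i x * (if t i is Some p then p (y - x) : R else 0))) => i _.
apply: cvgM (@wt_cvg i) _; case: (t i) => [p|]; last exact: cvg_cst.
rewrite linearB/=; under eq_fun do rewrite linearB/=.
by apply: cvgB; [exact: cvg_cst|move/weak_cvgP: ux; exact].
Qed.

Lemma vi_part_cvg : vi_part (u n) @[n --> \oo] --> vi_part x.
Proof.
apply: (@cvg_big R _ +%R 0 xpredT add_continuous _ \oo s
  (fun i n => wt i (u n) * (if t i is Some _ then 0 else 1 : R))
  (fun i => wt i x * (if t i is Some _ then 0 else 1 : R))) => i _.
by apply: cvgM (@wt_cvg i) _; exact: cvg_cst.
Qed.

End Limits.

(** The weighted mean of the test values is [pot (z l) 0 = 0], because the [d i - z l] average to
    zero. *)
Lemma galerkin_point n :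
  exists2 x, adh d x & forall i, (i <= n)%N -> pot x (d i - x) <= 0.
Proof.
pose z (l : 'I_n.+1 -> R) := \sum_i l i *: d i.
have zB l : simplex l -> adh d (z l).
  by move=> hl; apply: is_convex_simplex => // i; exact: adh_range.
have [|l hl|l hl hg] := @simplex_complementarity R n (fun i l => pot (z l) (d i - z l)).
- move=> l l0 hl hl0 ll i.
  have zz : z (l k) @[k --> \oo] --> z l0.
    apply: (@cvg_big X _ +%R 0 xpredT add_continuous _ \oo _
      (fun j k => l k j *: d j) (fun j => l0 j *: d j)) => j _.
    by apply: cvgZr_tmp; exact: ll.
  have zw := norm_weak_cvg zz.
  rewrite pot_diff; under eq_fun do rewrite pot_diff.
  apply: cvgD; first exact: sep_part_cvg zw _.
  apply: cvgM; first exact: vi_part_cvg zw.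
  apply: (demicontinuous_diag hFb hFp hAcomp) => // k.
  by apply: dA; exact: zB.
- rewrite pot_comb; under eq_bigr do rewrite scalerBr.
  rewrite big_split/= sumrN -scaler_suml hl.2 scale1r subrr.
  by rewrite pot0.
exists (z l); first exact: zB.
by move=> i ni; have := hg (Ordinal (ni : (i < n.+1)%N)).
Qed.

Lemma galerkin_limit (u : nat -> X) x : (forall n, adh d (u n)) -> adh d x ->
  weak_cvg u x -> (forall i, \forall n \near \oo, pot (u n) (d i - u n) <= 0) ->
  forall y, adh d y -> pot x (y - x) <= 0.
Proof.
move=> du dx ux hu y dy.
have [C C0 hC] := operator_bounded hFb hAcomp.
have [K K0 [vK sK]] := part_bounded.
have potK n y' : `|pot (u n) y'| <= (K + K * C) * `|y'|.
  rewrite /pot; apply: le_trans (ler_normB _ _) _; rewrite mulrDl lerD//.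
  rewrite normrM -mulrA (ger0_norm (vi_part_ge0 _)) ler_pM ?vi_part_ge0//.
  by apply: hC; exact: dA.
have K1 : 0 < K + K * C by rewrite addr_gt0// mulr_gt0.
(* The bound [potK], uniform in [n], carries the inequalities from the points [d i] to their
   closure, in particular to the limit [x]. *)
have lims y' e : adh d y' -> 0 < e -> \forall n \near \oo, pot (u n) (y' - u n) <= e.
  move=> dy' e0; have [i hi] := dy' _ (divr_gt0 e0 K1).
  apply: filterS (hu i) => n hn.
  have -> : y' - u n = (1 : R) *: (y' - d i) + (d i - u n) by rewrite scale1r addrA subrK.
  rewrite pot_linear/= [_ *: _]mul1r.
  have : pot (u n) (y' - d i) <= e.
    apply: le_trans (ler_norm _) _; apply: le_trans (potK _ _) _.
    by rewrite mulrC -ler_pdivlMr// distrC.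
  by lra.
have [b0|bpos] := eqVneq (vi_part x) 0.
  apply/ler_addgt0Pl => e e0; rewrite addr0.
  have [M hM] := weakly_compact_bounded hAcomp.
  have M0 : 0 <= M by apply: le_trans (hM x _); [|exact: dA].
  have vc := vi_part_cvg ux; have sc := @sep_part_cvg _ _ ux y.
  have vF : vi_part (u n) * F (u n) (u n - y) @[n --> \oo] --> (0 : R).
    apply/cvgr0Pnorm_le => a a0.
    have c0 : 0 < C * (M + M + 1) by rewrite mulr_gt0// ltr_wpDl// addr_ge0.
    rewrite b0 in vc; have /cvgr0_norm_le/(_ _ (divr_gt0 a0 c0)) := vc.
    apply: filterS => n hn; rewrite normrM.
    apply: le_trans (ler_pM _ _ hn (hC _ _ (dA (du n)))) _ => //.
    rewrite mulrAC ler_pdivrMr// ler_pM2l// ler_pM2l//.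
    by have := ler_normB (u n) y; have := hM _ (dA (du n)); have := hM _ (dA dy); lra.
  have pc : pot (u n) (y - u n) @[n --> \oo] --> pot x (y - x).
    rewrite pot_diff b0 mul0r; under eq_fun do rewrite pot_diff.
    exact: cvgD sc vF.
  by apply: (cvgr_to_le pc); exact: lims.
have {}bpos : 0 < vi_part x by rewrite lt_neqAle eq_sym bpos vi_part_ge0.
set b := vi_part x in bpos.
have half : \forall n \near \oo, b / 2 < vi_part (u n).
  by apply: (cvgr_gt _ (vi_part_cvg ux)); rewrite -/b; lra.
(* Testing with [x] itself: the separating part tends to zero, and division by a weight above
   [b / 2] leaves the premise of pseudomonotonicity. *)
have Fux e : 0 < e -> \forall n \near \oo, F (u n) (u n - x) <= e.
  move=> e0; have a0 : 0 < e * b / 4 by rewrite !mulr_gt0.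
  have sx : \forall n \near \oo, - (e * b / 4) < sep_part (u n) (x - u n).
    apply: (cvgr_gt _ (@sep_part_cvg _ _ ux x)).
    suff -> : sep_part x (x - x) = 0 by lra.
    by rewrite /sep_part big1// => i _; case: (t i) => [p|]; rewrite ?subrr ?linear0 mulr0.
  near=> n.
  have h1 : pot (u n) (x - u n) <= e * b / 4 by near: n; exact: lims.
  have h2 : b / 2 < vi_part (u n) by near: n.
  have h3 : - (e * b / 4) < sep_part (u n) (x - u n) by near: n.
  rewrite pot_diff in h1; rewrite leNgt; apply/negP => h4; nra.
have low := pseudomonotone_near hFp ux Fux y.
apply/ler_addgt0Pl => e e0; rewrite addr0.
have a0 : 0 < e / (2 * b) by rewrite divr_gt0// mulr_gt0.
have cl : (sep_part (u n) (y - u n) + vi_part (u n) * (F x (x - y) - e / (2 * b)))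
    @[n --> \oo] --> sep_part x (y - x) + b * (F x (x - y) - e / (2 * b)).
  by apply: cvgD (@sep_part_cvg _ _ ux y) _; apply: cvgMr_tmp; exact: vi_part_cvg.
have e2 : 0 < e / 2 by lra.
have : sep_part x (y - x) + b * (F x (x - y) - e / (2 * b)) <= e / 2.
  apply: (cvgr_to_le cl); near=> n.
  have h1 : pot (u n) (y - u n) <= e / 2 by near: n; exact: lims.
  have h2 : F x (x - y) <= F (u n) (u n - y) + e / (2 * b) by near: n; exact: low.
  rewrite pot_diff in h1; apply: le_trans h1.
  by rewrite lerD2l ler_wpM2l ?vi_part_ge0// lerBlDr.
have be : b * (e / (2 * b)) = e / 2 by field; rewrite gt_eqF.
by rewrite [b * (_ - _)]mulrBr be pot_diff -/b; lra.
Unshelve. all: by end_near. Qed.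

End Galerkin.

(** * Existence *)

Lemma tangent_cone_ge0 (R : realType) (X : normedModType R) (f : dual X) (S : set X) x d :
  (forall y, S y -> 0 <= f (y - x)) -> tangent_cone S x d -> 0 <= f d.
Proof.
move=> hS [u [t [Su ux t0 tc ud]]].
have fd : f ((t k)^-1 *: (u k - x)) @[k --> \oo] --> f d.
  by apply: cvg_comp ud _; exact: dual_continuous.
apply: (cvgr_to_ge fd); near=> k.
by rewrite linearZ/= mulr_ge0 ?invr_ge0 ?(ltW (t0 k))// hS.
Unshelve. all: by end_near. Qed.

Section Existence.
Variables (R : realType) (X : normedModType R) (F : X -> dual X) (Phi : X -> set X).
Variable A : set X.
Hypotheses (hFb : bounded_operator F) (hFp : pseudomonotone F)
  (hPhi : weakly_mosco_continuous Phi) (hA0 : A !=set0)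
  (hAconv : is_convex A) (hAcomp : weakly_compact A)
  (hPhi0 : forall x, A x -> Phi x !=set0) (hPhic : forall x, A x -> closed (Phi x))
  (hPhiconv : forall x, A x -> is_convex (Phi x)) (hPhiA : forall x, A x -> Phi x `<=` A).

(* A countable set, dense in a closed convex subset [adh d] of [A], that almost contains
   witnesses of [y \in Phi x] and [b < F x (x - y)]: by [locally_good] a witness is good on
   a whole ball, and one witness is kept for each ball with a centre in the set. *)
Lemma saturated_sequence : exists d : nat -> X, [/\ adh d `<=` A, is_convex (adh d) &
  forall x y a, adh d x -> Phi x y -> 0 < a -> exists z, [/\ adh d z,
    exists2 v, Phi x v & `|z - v| <= a & F x (x - y) - a < F x (x - z)]].
Proof.
(* The key holds the radius around the centre [c], the tolerance for the distance to [Phi x], and a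
   rational lower bound. *)
pose good (k : nat * nat * rat) c y := A y /\ forall x, A x -> `|x - c| <= 1 / k.1.1.+1%:R ->
  (exists2 v, Phi x v & `|y - v| <= 1 / k.1.2.+1%:R) /\ ratr k.2 < F x (x - y).
(* When no good point exists the centre is returned, so that the generated set stays in [A]. *)
have /choice[sel hsel] : forall kc : (nat * nat * rat) * X, exists y, A kc.2 -> A y /\
    ((exists y', good kc.1 kc.2 y') -> good kc.1 kc.2 y).
  move=> kc; have [[y' hy']|nex] := pselect (exists y', good kc.1 kc.2 y').
    by exists y' => _; split=> //; case: hy'.
  by exists kc.2.
pose op (j : rat + nat * nat * rat) (x y : X) := match j with
  | inl t => if (0 <= (ratr t : R) <= 1) then ratr t *: x + (1 - ratr t) *: y else x
  | inr k => sel (k, x) end.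
have [a0 Aa0] := hA0.
have [|d Ad dop] := @countable_closure X (rat + nat * nat * rat)%type op a0 A Aa0.
  move=> [t|k] x y Ax Ay /=; last by case: (hsel (k, x) Ax).
  by case: ifP => // t01; exact: hAconv.
have dA : adh d `<=` A by apply: adh_sub => //; exact: weakly_compact_closed.
exists d; split=> //.
  apply: adh_is_convex => t m n t01.
  by have [k] := dop (inl t) m n; rewrite /= t01; exists k.
move=> x y a dx Pxy a0'.
have bound_lt (e : R) : 0 < e -> exists n : nat, 1 / n.+1%:R <= e.
  move=> e0; exists (Num.bound e^-1); rewrite div1r invf_ple ?posrE//.
  apply: le_trans (ltW (archi_boundP _)) _; first by rewrite invr_ge0 ltW.
  by rewrite ler_nat.
have [j hj] := bound_lt _ a0'.
have [b] : exists b : rat, ratr b \in `]F x (x - y) - a, F x (x - y)[%R.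
  by apply: rat_in_itvoo; rewrite ltrBlDr ltrDl.
rewrite in_itv/= => /andP[ab bF].
have j0 : 0 < 1 / j.+1%:R :> R by rewrite divr_gt0.
have [r r0 hr] := locally_good hFb hFp hPhi hAcomp (dA _ dx) Pxy j0 bF.
(* With radius at most [r / 2], the ball around a nearby [d n] lies in the good ball around [x], so
   [y] is eligible; as it also contains [x], the selected point is good at [x]. *)
have [i hi] := bound_lt (r / 2) ltac:(by rewrite divr_gt0).
have i0 : 0 < 1 / i.+1%:R :> R by rewrite divr_gt0.
have [n hn] := dx _ i0.
have [_ []] := hsel ((i, j, b), d n) (Ad n).
  exists y; split; first exact: (hPhiA (dA _ dx)).
  move=> z Az /= zd; apply: hr => //.
  by apply: le_trans (ler_distD (d n) z x) _; rewrite [r]splitr lerD// (le_trans _ hi).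
have [k dk] := dop (inr (i, j, b)) n n; rewrite -[sel _]/(op (inr (i, j, b)) (d n) (d n)) -dk.
move=> Adk /(_ x (dA _ dx)); rewrite distrC => /(_ hn)/=[[v Pv kv] bk].
exists (d k); split; first exact: adh_range.
- by exists v => //; exact: le_trans kv hj.
- exact: lt_trans bk.
Qed.

Lemma qvi_exists :
  exists2 x, A x & Phi x x /\ forall y, Phi x y -> F x (x - y) <= 0.
Proof.
apply: contrapT => nosol.
have improve x : A x -> Phi x x -> exists2 y, Phi x y & 0 < F x (x - y).
  move=> Ax Pxx; apply: contrapT => ny; apply: nosol; exists x => //; split=> // y Pxy.
  by rewrite leNgt; apply/negP => lt; apply: ny; exists y.
have [d [dA dc dsat]] := saturated_sequence.
have [q qsep] := separating_sequence d.
pose local (t : option (dual X)) z := if t is Some p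
  then exists2 e, 0 < e & forall v, Phi z v -> p z + e <= p v
  else exists2 y, Phi z y & 0 < F z (z - y).
have /choice[mt hmt] : forall x, exists mt : nat * option (dual X), adh d x ->
    forall z, adh d z -> 0 < weight q mt.1 x z -> local mt.2 z.
  move=> x; have [dx|ndx] := pselect (adh d x); last by exists (0%N, None).
  suff [t ht] : exists t, ~ (forall m, exists z,
      [/\ adh d z, 0 < weight q m x z & ~ local t z]).
    apply: contrapT => nmt; apply: ht => m; apply: contrapT => nz; apply: nmt.
    exists (m, t) => _ z dz wz; apply: contrapT => nl; apply: nz; by exists z.
  (* If a refutation fails in the [m]-th neighbourhood for every [m], the failures form a sequence
     converging weakly to [x], against its stability. *)
  have seq_cvg t : (forall m, exists z, [/\ adh d z, 0 < weight q m x z & ~ local t z]) ->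
      exists u : nat -> X, [/\ forall k, A (u k), weak_cvg u x & forall k, ~ local t (u k)].
    move=> /choice[u hu]; exists u; split=> [k||k]; try by case: (hu k) => // /dA.
    apply: (adh_weak_cvg hAcomp dA dc qsep) => // [n|]; first by case: (hu n).
    by apply: (@gap_seq _ _ q u x) => m; rewrite -weight_gt0; case: (hu m).
  have Ax := dA _ dx.
  have [Pxx|nPxx] := pselect (Phi x x).
    exists None => /seq_cvg[u [Au ux nu]].
    have [y Pxy Fxy] := improve _ Ax Pxx.
    apply: (improvement_stable hFb hFp hPhi hAcomp Au ux Pxx Pxy Fxy) => k v Pv.
    by rewrite leNgt; apply/negP => lt; apply: (nu k); exists v.
  have [p [e [e0 hp]]] := separation (hPhiconv Ax) (hPhic Ax) nPxx.
  exists (Some p) => /seq_cvg[u [Au ux nu]].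
  apply: (separation_stable hPhi hAconv hAcomp hPhiA Au ux hp e0) => k.
  apply: contrapT => nv; apply: (nu k); exists (e / 2); first by rewrite divr_gt0.
  move=> v Pv; rewrite leNgt; apply/negP => lt; apply: nv; by exists v.
pose m x := (mt x).1; pose t x := (mt x).2.
have [s sB scov] := @finite_cover R X A (adh d) (fun x => [set w | 0 < weight q (m x) x w])
  hAcomp dA dc (@adh_closed R X d) (fun x _ => weight_nbhs (weight_self q (m x) x)).
have /choice[u hu] : forall n, exists x, adh d x /\
    forall i, (i <= n)%N -> pot F q s m t x (d i - x) <= 0.
  move=> n; have [x dx hx] := galerkin_point q s m t hFb hFp hAcomp dA dc n.
  by exists x.
have [r hr [x dx ux]] := adh_weak_subseq hAcomp dA dc (fun n => (hu n).1).
have potx : forall y, adh d y -> pot F q s m t x (y - x) <= 0.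
  apply: (galerkin_limit hFb hFp hAcomp dA _ dx ux) => [n|i]; first by case: (hu (r n)).
  exists i => // n /= ni; apply: (hu (r n)).2.
  exact: leq_trans ni (leq_extraction hr n).
have Ax := dA _ dx.
(* If no active centre has [t i = None], any point of [Phi x] will do. *)
have [y Pxy hy] : exists2 y, Phi x y &
    forall i, i \in s -> 0 < weight q (m i) i x -> t i = None -> 0 < F x (x - y).
  have [[i [si wi ti]]|ni] := pselect (exists i, [/\ i \in s, 0 < weight q (m i) i x & t i = None]).
    have := hmt i (sB i si) x dx wi; rewrite -/(t i) ti => -[y Pxy Fxy].
    by exists y.
  by have [y Pxy] := hPhi0 Ax; exists y => // i si wi ti; exfalso; apply: ni; exists i.
pose h i z := if t i is Some p then p (z - x) : R else F x (x - z).
(* [a] is the error allowed on [z]: [e / 2 / M] keeps half of a separation margin, and [F x (x - y)]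
   is exactly what can be lost in the variational inequality. *)
have [||a a0 ha] := @common_margin R X s (fun i a => forall z v, Phi x v -> `|z - v| <= a ->
    F x (x - y) - a < F x (x - z) -> 0 < weight q (m i) i x -> 0 < h i z).
- by move=> i b c /andP[b0 bc] hc z v Pv zv Fz; apply: (hc z v) => //; lra.
- move=> i si; have [wi|wi] := ltP 0 (weight q (m i) i x); last first.
    by exists 1 => // z v _ _ _; rewrite ltNge wi.
  have := hmt i (sB i si) x dx wi; rewrite -/(t i) /h.
  case ti: (t i) => [p|] /=.
    move=> [e e0 pe]; have [M M0 hM] := dual_bounded p.
    exists (e / 2 / M) => [|z v Pv zv _ _]; first by rewrite !divr_gt0.
    have := pe v Pv; have : `|p (z - v)| <= e / 2.
      by apply: le_trans (hM _) _; rewrite mulrC -ler_pdivlMr.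
    by rewrite ler_norml !linearB/= => /andP[? _]; lra.
  move=> _; have Fxy := hy i si wi ti.
  by exists (F x (x - y)) => // z v _ _; rewrite subrr.
have [z [dz [v Pv zv] Fz]] := dsat x y a dx Pxy a0.
have term_ge0 i : i \in s -> 0 <= weight q (m i) i x * h i z.
  move=> si; have := weight_ge0 q (m i) i x; rewrite le_eqVlt => /predU1P[<-|wi].
    by rewrite mul0r.
  by rewrite mulr_ge0 ?(ltW wi)// ltW// (ha i si z v).
have potE : pot F q s m t x (z - x) = \sum_(i <- s) weight q (m i) i x * h i z.
  rewrite pot_diff /sep_part /vi_part mulr_suml -big_split/=.
  by apply: eq_bigr => i _; rewrite /h; case: (t i) => [p|]; ring.
have [i si /= wi] := scov x dx.
(* The terms are nonnegative and their sum is at most zero by [potx], yet the term of a centre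
   covering [x] is positive. *)
have : \sum_(i <- s) weight q (m i) i x * h i z == 0.
  by rewrite eq_le -{1}potE potx//= big_seq sumr_ge0.
rewrite big_seq psumr_eq0// => /allP/(_ i si); rewrite si/= => /eqP e.
by have := mulr_gt0 wi (ha i si z v Pv zv Fz wi); rewrite e ltxx.
Qed.

End Existence.

Unset Implicit Arguments.

Theorem theorem4p4 (R : realType) (X : completeNormedModType R)
    (F : X -> dual X) (Phi : X -> set X)
    (hFb : bounded_operator F) (hFp : pseudomonotone F)
    (hPhi : weakly_mosco_continuous Phi)
    (A : set X) (hA0 : A !=set0) (hAconv : convex_set A)
    (hAcomp : weakly_compact A)
    (hPhiA : forall x, A x ->
      [/\ Phi x !=set0, closed (Phi x), convex_set (Phi x) & Phi x `<=` A]) :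
  exists2 x, A x & qvi_solution F Phi x.
Proof.
have [|||||x Ax [Pxx hx]] := @qvi_exists R X F Phi A hFb hFp hPhi hA0 _ hAcomp.
- exact/convex_setP.
- by move=> x /hPhiA[].
- by move=> x /hPhiA[].
- by move=> x /hPhiA[_ _ /convex_setP].
- by move=> x /hPhiA[].
exists x => //; split=> // d; apply: tangent_cone_ge0 => y /hx.
by rewrite -[x - y]opprB linearN/= oppr_le0.
Qed.
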